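(* Let $L$ be a background language, $\mathfrak{B}$ an atomic base over $L$, $\mathtt{Gen}$ the Gentzen-language of grounding over $\mathfrak{B}$, and $\mathtt{GG}$ the system of Gentzen-grounding over the enriched language $\mathtt{Gen}^\varepsilon$. Let $U$ be a term of $\mathtt{Gen}$ of type $\beta$, with set of free typed-variables $FV^T(U)=\{\xi^{\alpha_1},\dots,\xi^{\alpha_n}\}$. Then $$\xi^{\alpha_1}:\alpha_1,\ \dots,\ \xi^{\alpha_n}:\alpha_n\ \vdash_{\mathtt{GG}}\ U:\beta .$$
   Context: **Background language and base.** $L$ is a first-order language with logical constants $\wedge,\vee,\to,\forall,\exists$ and an atomic constant $\bot$; $\mathrm{TERM}_L,\mathrm{ATOM}_L,\mathrm{FORM}_L$ are its sets of terms, atomic formulas and formulas. An atomic system over $L$ is a pair $\mathtt{S}=\langle L^*,\mathfrak{R}\rangle$ with $L^*\subseteq L$ and $\mathfrak{R}$ a recursively axiomatisable set of production rules from $\alpha_1,\dots,\alpha_n$ to $\beta$, where each $\alpha_i$ is an atomic formula of $L^*$ other than $\bot$, $\beta$ is an atomic formula of $L^*$ or $\bot$, and every variable free in $\beta$ is free in some $\alpha_i$. $\mathrm{DER}_{\mathtt{S}}$ is the set of its derivations. An atomic base $\mathfrak{B}$ over $L$ is a triple: the individual constants of $L$, the relational constants of $L$, and an atomic system $\mathtt{S}$ over $L$. **The language $\mathtt{Gen}$** has only typed terms (types are formulas of $L$). $\mathrm{TERM}_{\mathtt{Gen}}$ is the smallest set with the following closure conditions (writing $T:\alpha$ for ''$T$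 is a term of type $\alpha$''; bound variables are written after the operational symbol): - a constant $\delta:\alpha$ for each derivation in $\mathrm{DER}_{\mathtt{S}}$ with no undischarged assumptions and no unbound variables, $\alpha$ being its conclusion; - typed-variables $\xi^\alpha_i:\alpha$ ($\alpha\in\mathrm{FORM}_L$, $i\in\mathbb{N}$; indices are often omitted); - if $T:\alpha$, $U:\beta$ then $\wedge I(T,U):\alpha\wedge\beta$; if $T:\alpha_1\wedge\alpha_2$ then $\wedge_{E,i}(T):\alpha_i$ ($i=1,2$); - if $T:\alpha_i$ then $\vee I[\alpha_i\rhd\alpha_1\vee\alpha_2](T):\alpha_1\vee\alpha_2$; if $T:\alpha\vee\beta$, $U:\gamma$, $Z:\gamma$ then $\vee E\,\xi^\alpha\,\xi^\beta(T,U,Z):\gamma$ (binding $\xi^\alpha$ in $U$ and $\xi^\beta$ in $Z$); - if $T:\beta$ then $\to\! I\,\xi^\alpha(T):\alpha\to\beta$ (binding $\xi^\alpha$); if $T:\alpha\to\beta$, $U:\alpha$ then $\to\! E(T,U):\beta$; - if $U:\alpha(x)$ then $\forall I\,x(U):\forall y\,\alpha(y)$ (binding $x$), provided $x\notin FV(\gamma)$ for every $\xi^\gamma\in FV^T(U)$; if $T:\forall x\,\alpha(x)$ then $\forall E[\forall x\alpha(x)\rhd\alpha(t)](T):\alpha(t)$, $t$ free for $x$ in $\alpha(x)$; - if $T:\alpha(t)$ then $\exists I[\alpha(t)\rhd\exists x\alpha(x)](T):\exists x\,\alpha(x)$, $t$ free for $x$ in $\alpha(x)$; if $T:\exists x\,\alpha(x)$,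 $U:\beta$ then $\exists E\,y\,\xi^{\alpha(y)}(T,U):\beta$ (binding $y$ and $\xi^{\alpha(y)}$ in $U$), provided $y\notin FV(\beta)$ and $y\notin FV(\gamma)$ for every $\xi^\gamma\in FV^T(U)$ with $\gamma\neq\alpha(y)$; - if $T:\bot$ then $\bot_\alpha(T):\alpha$. $FV^I(T)$, $FV^T(T)$ are the sets of free individual variables and free typed-variables of $T$. Individual variables occur in a term via the types of its typed-variables and the operational types. Substitutions of individual terms for individual variables (also acting on types of typed-variables) and of terms $W:\alpha$ for $\xi^\alpha$ are capture-avoiding. $T(\xi^\alpha)$, $T(U)$, $T(x)$, $T(t)$ have the usual meaning with respect to such substitutions. **The enriched language $\mathtt{Gen}^\varepsilon$** adds functional variables $\mathtt{h}^\alpha_x$ and $\mathtt{f}^\alpha$ (countably many of each kind, for each $\alpha\in\mathrm{FORM}_L$), binary predicates $Gr$ and $\equiv$, and logical constants $\times$ (and), $+$ (or), $\supset$ (implies), $\Pi$ (for all), $\mathfrak{E}$ (exists), $\bot^G$ (absurdity). New terms: $\mathtt{h}^\alpha_x(t):\alpha(t/x)$ for $t\in\mathrm{TERM}_L$ and $\mathtt{f}^\alpha(T):\alpha$ for $T\in\mathrm{TERM}_{\mathtt{Gen}}$; terms are closed under the operational symbols as before. Atomic formulas: $Gr(T,\alpha)$ for $T$ a term of type $\alpha$, written $T:\alpha$; $T\equiv U$ for $T,U$ terms of the same type; $\bot^G$. Formulas are built with $\times,+,\supset$ and with $\Pi\nu$, $\mathfrak{E}\nu$, $\nu$ any individual,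 typed- or functional variable. Substitution for functional variables: $\mathtt{h}^\beta_x(t)[U/\mathtt{h}^\beta_x]=U[t/x]$ for $U:\beta$ with $x\notin FV(\alpha)$ for all $\xi^\alpha\in FV^T(U)$, and $\mathtt{f}^\alpha(Z)[U/\mathtt{f}^\alpha]=U$ for $U:\alpha$; terms substituted for typed- and functional variables must belong to $\mathrm{TERM}_{\mathtt{Gen}}$. **The system $\mathtt{GG}$** is a natural deduction system; any formula of $\mathtt{Gen}^\varepsilon$ may be assumed. $\mathfrak{G}\vdash_{\mathtt{GG}}A$ means $A$ is derivable from undischarged assumptions in $\mathfrak{G}$. Its rules are as follows. *Type introductions.* Axiom $\delta:\alpha$ for each constant $\delta$ naming a derivation with conclusion $\alpha$. From $T:\alpha$ and $U:\beta$ infer $\wedge I(T,U):\alpha\wedge\beta$. From $T:\alpha_i$ infer $\vee I[\alpha_i\rhd\alpha_1\vee\alpha_2](T):\alpha_1\vee\alpha_2$. From a derivation of $T(\xi^\alpha):\beta$ from $\xi^\alpha:\alpha$ infer $\to\! I\,\xi^\alpha(T(\xi^\alpha)):\alpha\to\beta$, discharging $\xi^\alpha:\alpha$ ($\xi^\alpha$ not free in other undischarged assumptions). From $T(x):\alpha(x)$ infer $\forall I\,y(T(y/x)):\forall y\,\alpha(y/x)$ ($x$ not free in undischarged assumptions). From $T:\alpha(t/x)$ infer $\exists I[\alpha(t/x)\rhd\exists x\alpha(x)](T):\exists x\,\alpha(x)$. *Type eliminations* (in each case infer $A$ from the major premise and the derivation(s) of $A$ from the listed dischargeable assumptions): - $D_\wedge$: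 major $T:\alpha\wedge\beta$; discharge $T\equiv\wedge I(\xi^\alpha,\xi^\beta)$, $\xi^\alpha:\alpha$, $\xi^\beta:\beta$. - $D_\vee$: major $T:\alpha\vee\beta$; two minor derivations of $A$, one discharging $T\equiv\vee I(\xi^\alpha)$, $\xi^\alpha:\alpha$, the other $T\equiv\vee I(\xi^\beta)$, $\xi^\beta:\beta$. - $D_\to$: major $T:\alpha\to\beta$; discharge $T\equiv\;\to\! I\,\xi^\alpha(\mathtt{f}^\beta(\xi^\alpha))$, $\Pi\xi^\alpha(\xi^\alpha:\alpha\supset\mathtt{f}^\beta(\xi^\alpha):\beta)$. - $D_\forall$: major $T:\forall x\,\alpha(x)$; discharge $T\equiv\forall I\,x(\mathtt{h}^{\alpha(x)}_x(x))$, $\Pi x(\mathtt{h}^{\alpha(x)}_x(x):\alpha(x))$. - $D_\exists$: major $T:\exists x\,\alpha(x)$; discharge $T\equiv\exists I(\xi^{\alpha(x)})$, $\xi^{\alpha(x)}:\alpha(x)$. - $\bot$: from $T:\bot$ infer $\bot^G$. The proper variables ($\xi^\alpha,\xi^\beta$ in $D_\wedge$, $D_\vee$; $\mathtt{f}^\beta$ in $D_\to$; $\mathtt{h}^{\alpha(x)}_x$ in $D_\forall$, also after replacing $x$ by any $t$; $x$ and $\xi^{\alpha(x)}$ in $D_\exists$) must not be free in $A$ or in undischarged assumptions on which the minor premise $A$ depends other than those discharged by the rule. *Equivalence rules.* Axiom $T\equiv T$; symmetry; transitivity; preservation of denotation ($\equiv_P$): from $T\equiv U$ and $U:\alpha$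 infer $T:\alpha$. Congruence: for each operational symbol of $\mathtt{Gen}$ listed above ($\wedge I$, $\wedge_{E,i}$, $\vee I$, $\vee E$, $\to\! I$, $\to\! E$, $\forall I$, $\forall E$, $\exists I$, $\exists E$, with the same bound variables on both sides), from equivalence of corresponding arguments infer equivalence of the resulting terms. Injectivity for primitive symbols: from $\wedge I(T_1,T_2)\equiv\wedge I(U_1,U_2)$ infer $T_i\equiv U_i$; from $sI(T)\equiv sI(U)$ infer $T\equiv U$, for $sI$ one of $\vee I[\alpha_i\rhd\alpha_1\vee\alpha_2]$, $\to\! I\,\xi^\alpha$, $\forall I\,x$, $\exists I$. Equations (axioms): $\wedge_{E,i}(\wedge I(T_1,T_2))\equiv T_i$; $\vee E\,\xi^{\alpha_1}\xi^{\alpha_2}(\vee I[\alpha_i\rhd\alpha_1\vee\alpha_2](T),U_1(\xi^{\alpha_1}),U_2(\xi^{\alpha_2}))\equiv U_i(T)$; $\to\! E(\to\! I\,\xi^\alpha(T(\xi^\alpha)),U)\equiv T(U)$; $\forall E[\forall x\alpha(x)\rhd\alpha(t/x)](\forall I\,x(T(x)))\equiv T(t)$; $\exists E\,x\,\xi^{\alpha(x)}(\exists I[\alpha(t/x)\rhd\exists x\alpha(x)](T),U(x,\xi^{\alpha(x)}))\equiv U(t,T)$. *Logic.* Gentzen's introduction and elimination rules of first-order intuitionistic natural deduction for $\times,+,\supset,\Pi,\mathfrak{E}$, and from $\bot^G$ infer any $A$. Quantifier rules apply to individual, typed- and functional variables, with the usual proper-variable restrictions; the instantiating term $\tau$ in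 $\Pi$-elimination and $\mathfrak{E}$-introduction is a term of $L$ or of $\mathtt{Gen}$ (or the quantified variable itself), of type $\alpha$ if the variable is $\xi^\alpha$ or $\mathtt{f}^\alpha$, and, if the variable is $\mathtt{h}^\beta_x$, of type $\beta$ with $x\notin FV(\alpha)$ for all $\xi^\alpha\in FV^T(\tau)$.
   Formalization: In forming ∃E y ξ^{α(y)}(T,U) it is also required that y is not free in ∃xα(x), and y may be free in the type of no free typed-variable of U except the bound ξ^{α(y)} itself, so not in another variable of the same type with a different index. *)

(* Defs.v *)
(* Syntax is locally nameless.  Free variables are named and carry the index
   and the type they have in the object language; bound variables are de Bruijn
   indices, with one index space for each of the four kinds of variable.  Hence
   equality is identity up to renaming of bound variables and substitution is
   capture-avoiding.  Typing and inference rules are stated with named binders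
   (allI x T, impI i a T, pAll v A, and so on): these are functions closing
   their body over the given variable. *)
From HB Require Import structures.
From Stdlib Require List.
From mathcomp Require Import all_boot.

Set Implicit Arguments.
Unset Strict Implicit.
Unset Printing Implicit Defensive.

Record language := Language {
  ind_const : countType;
  fun_sym : countType;
  fun_ar : fun_sym -> nat;
  rel_sym : countType;
  rel_ar : rel_sym -> nat }.

Inductive term (L : language) : Type :=
| Var of nat
| Bnd of nat
| Cst of ind_const L
| App of fun_sym L & seq (term L).

Inductive form (L : language) : Type :=
| FBot
| FRel of rel_sym L & seq (term L)
| FAnd of form L & form L
| FOr of form L & form L
| FImp of form L & form L
| FAll of form L
| FEx of form L.

Arguments Var {L} _.
Arguments Bnd {L} _.
Arguments Cst {L} _.
Arguments App {L} _ _.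
Arguments FBot {L}.
Arguments FRel {L} _ _.

Section Coding.
Variable L : language.

Fixpoint term_rect' (P : term L -> Prop)
    (hV : forall x, P (Var x)) (hB : forall k, P (Bnd k))
    (hC : forall c, P (Cst c))
    (hA : forall f ts, (forall i, P (nth (Var 0) ts i)) -> P (App f ts))
    (t : term L) {struct t} : P t :=
  match t with
  | Var x => hV x
  | Bnd k => hB k
  | Cst c => hC c
  | App f ts => hA f ts
      ((fix aux ss : forall i, P (nth (Var 0) ss i) :=
        match ss with
        | [::] => fun i => match i with 0 => hV 0 | _.+1 => hV 0 end
        | s :: ss' => fun i =>
            match i with
            | 0 => term_rect' hV hB hC hA s
            | j.+1 => aux ss' j
            end
        end) ts)
  end.

Fixpoint term_enc (t : term L) : GenTree.tree nat :=
  match t with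
  | Var x => GenTree.Node 0 [:: GenTree.Leaf x]
  | Bnd k => GenTree.Node 1 [:: GenTree.Leaf k]
  | Cst c => GenTree.Node 2 [:: GenTree.Leaf (pickle c)]
  | App f ts => GenTree.Node 3 (GenTree.Leaf (pickle f) :: map term_enc ts)
  end.

Fixpoint term_dec (g : GenTree.tree nat) : option (term L) :=
  match g with
  | GenTree.Node 0 [:: GenTree.Leaf x] => Some (Var x)
  | GenTree.Node 1 [:: GenTree.Leaf k] => Some (Bnd k)
  | GenTree.Node 2 [:: GenTree.Leaf c] => omap Cst (unpickle c)
  | GenTree.Node 3 (GenTree.Leaf f :: gs) =>
      omap (fun f => App f (pmap term_dec gs)) (unpickle f)
  | _ => None
  end.

Lemma term_encK : pcancel term_enc term_dec.
Proof.
elim/term_rect' => //= [c|f ts IH]; rewrite pickleK //=.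
congr (Some (App f _)).
elim: ts IH => //= t ts IHts IH.
by rewrite (IH 0) /= IHts // => i; exact: (IH i.+1).
Qed.

HB.instance Definition _ := Countable.copy (term L) (pcan_type term_encK).

Fixpoint form_enc (a : form L) : GenTree.tree (nat + term L) :=
  match a with
  | FBot => GenTree.Node 0 [::]
  | FRel r ts => GenTree.Node 1
      (GenTree.Leaf (inl (pickle r)) :: [seq GenTree.Leaf (inr t) | t <- ts])
  | FAnd a b => GenTree.Node 2 [:: form_enc a; form_enc b]
  | FOr a b => GenTree.Node 3 [:: form_enc a; form_enc b]
  | FImp a b => GenTree.Node 4 [:: form_enc a; form_enc b]
  | FAll a => GenTree.Node 5 [:: form_enc a]
  | FEx a => GenTree.Node 6 [:: form_enc a]
  end.

Definition leaf_term (g : GenTree.tree (nat + term L)) : option (term L) :=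
  if g is GenTree.Leaf (inr t) then Some t else None.

Definition omap2 A B C (f : A -> B -> C) x y :=
  if x is Some a then omap (f a) y else None.

Fixpoint form_dec (g : GenTree.tree (nat + term L)) : option (form L) :=
  match g with
  | GenTree.Node 0 [::] => Some FBot
  | GenTree.Node 1 (GenTree.Leaf (inl r) :: gs) =>
      omap (fun r => FRel r (pmap leaf_term gs)) (unpickle r)
  | GenTree.Node 2 [:: g; h] => omap2 (@FAnd L) (form_dec g) (form_dec h)
  | GenTree.Node 3 [:: g; h] => omap2 (@FOr L) (form_dec g) (form_dec h)
  | GenTree.Node 4 [:: g; h] => omap2 (@FImp L) (form_dec g) (form_dec h)
  | GenTree.Node 5 [:: g] => omap (@FAll L) (form_dec g)
  | GenTree.Node 6 [:: g] => omap (@FEx L) (form_dec g)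
  | _ => None
  end.

Lemma form_encK : pcancel form_enc form_dec.
Proof.
elim=> //= [r ts|a -> b ->|a -> b ->|a -> b ->|a ->|a ->] //=.
rewrite pickleK /=; congr (Some (FRel r _)).
by elim: ts => //= t ts ->.
Qed.

HB.instance Definition _ := Countable.copy (form L) (pcan_type form_encK).

End Coding.

Section Substitution.
Variable L : language.
Implicit Types (t u : term L) (a : form L).

Fixpoint tm_map (fv fb : nat -> term L) t : term L :=
  match t with
  | Var x => fv x
  | Bnd k => fb k
  | Cst c => Cst c
  | App f ts => App f (map (tm_map fv fb) ts)
  end.

(* The first argument of fv and fb is the number of quantifiers crossed. *)
Fixpoint fm_map (fv fb : nat -> nat -> term L) (k : nat) a : form L :=
  match a with
  | FBot => FBot
  | FRel r ts => FRel r (map (tm_map (fv k) (fb k)) ts)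
  | FAnd a b => FAnd (fm_map fv fb k a) (fm_map fv fb k b)
  | FOr a b => FOr (fm_map fv fb k a) (fm_map fv fb k b)
  | FImp a b => FImp (fm_map fv fb k a) (fm_map fv fb k b)
  | FAll a => FAll (fm_map fv fb k.+1 a)
  | FEx a => FEx (fm_map fv fb k.+1 a)
  end.

Definition lift_tm (k : nat) t := tm_map Var (fun j => Bnd (j + k)) t.

(* t may itself contain indices bound further out: this occurs when a term is
   substituted for a functional variable h in h(t). *)
Definition open_var t (k j : nat) : term L :=
  if j == k then lift_tm k t else Bnd j.
Definition close_var (x k y : nat) : term L :=
  if y == x then Bnd k else Var y.

Definition keep_var (k x : nat) : term L := Var x.
Definition keep_bnd (k j : nat) : term L := Bnd j.

(* If a is a body (one dangling index), inst_fm t a is a(t). *)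
Definition inst_fm t a := fm_map keep_var (open_var t) 0 a.
Definition bind_fm (x : nat) a := fm_map (close_var x) keep_bnd 0 a.

Definition fAll (x : nat) a := FAll (bind_fm x a).

Definition sub_fm (s : nat -> term L) a := fm_map (fun _ => s) keep_bnd 0 a.

Fixpoint fv_tm t : seq nat :=
  match t with
  | Var x => [:: x]
  | App _ ts => flatten (map fv_tm ts)
  | _ => [::]
  end.

Fixpoint fv_fm a : seq nat :=
  match a with
  | FBot => [::]
  | FRel _ ts => flatten (map fv_tm ts)
  | FAnd a b | FOr a b | FImp a b => fv_fm a ++ fv_fm b
  | FAll a | FEx a => fv_fm a
  end.

(* Arities are respected and all dangling indices are below k; k = 0 gives the
   terms and formulas of L, k = 1 the bodies of quantified formulas. *)
Fixpoint wf_tm (k : nat) t : bool :=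
  match t with
  | Bnd j => j < k
  | App f ts => (size ts == fun_ar f) && all (wf_tm k) ts
  | _ => true
  end.

Fixpoint wf_fm (k : nat) a : bool :=
  match a with
  | FBot => true
  | FRel r ts => (size ts == rel_ar r) && all (wf_tm k) ts
  | FAnd a b | FOr a b | FImp a b => wf_fm k a && wf_fm k b
  | FAll a | FEx a => wf_fm k.+1 a
  end.

Definition TERM_L t := wf_tm 0 t.
Definition FORM_L a := wf_fm 0 a.

End Substitution.

Inductive recfun : Type :=
| RZero
| RSucc
| RProj of nat
| RComp of recfun & seq recfun
| RPrec of recfun & recfun
| RMu of recfun.

(* rec_eval f v y: the partial recursive function f is defined at v, with
   value y. *)
Inductive rec_eval : recfun -> seq nat -> nat -> Prop :=
| ev_zero v : rec_eval RZero v 0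
| ev_succ x v : rec_eval RSucc (x :: v) x.+1
| ev_proj i v : i < size v -> rec_eval (RProj i) v (nth 0 v i)
| ev_comp f gs v ws y :
    rec_evals gs v ws -> rec_eval f ws y -> rec_eval (RComp f gs) v y
| ev_prec0 f g v y : rec_eval f v y -> rec_eval (RPrec f g) (0 :: v) y
| ev_precS f g n v y z :
    rec_eval (RPrec f g) (n :: v) y -> rec_eval g (n :: y :: v) z ->
    rec_eval (RPrec f g) (n.+1 :: v) z
| ev_mu f v n (y : nat -> nat) :
    (forall m, m < n -> rec_eval f (m :: v) (y m).+1) ->
    rec_eval f (n :: v) 0 -> rec_eval (RMu f) v n
with rec_evals : seq recfun -> seq nat -> seq nat -> Prop :=
| evs_nil v : rec_evals [::] v [::]
| evs_cons f fs v w ws :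
    rec_eval f v w -> rec_evals fs v ws ->
    rec_evals (f :: fs) v (w :: ws).

Definition recursive (T : countType) (A : T -> Prop) : Prop :=
  exists f, forall x,
    (A x -> rec_eval f [:: pickle x] 1) /\
    (~ A x -> rec_eval f [:: pickle x] 0).

Record sublanguage (L : language) := Sublanguage {
  sub_const : pred (ind_const L);
  sub_fun : pred (fun_sym L);
  sub_rel : pred (rel_sym L) }.

Definition rule (L : language) : Type := (seq (form L) * form L)%type.

(* A derivation is a tree whose leaves are assumptions and whose nodes are
   inferences, labelled with their conclusion. *)
Inductive dtree (L : language) : Type :=
| DAsm of form L
| DInf of form L & seq (dtree L).

Section AtomicSystems.
Variable L : language.
Implicit Types (S : sublanguage L) (R : rule L -> Prop).

Fixpoint tm_over S (t : term L) : bool :=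
  match t with
  | Var _ | Bnd _ => true
  | Cst c => sub_const S c
  | App f ts => sub_fun S f && all (tm_over S) ts
  end.

(* Atomic formulas of the sublanguage, other than absurdity. *)
Definition rel_atom S (a : form L) : bool :=
  if a is FRel r ts then [&& FORM_L a, sub_rel S r & all (tm_over S) ts]
  else false.

Definition atom S (a : form L) : bool := (a == FBot) || rel_atom S a.

Definition production_rule S (r : rule L) : Prop :=
  [/\ all (rel_atom S) r.1, atom S r.2 &
      {subset fv_fm r.2 <= flatten (map (@fv_fm L) r.1)}].

Definition concl (d : dtree L) : form L :=
  match d with DAsm a => a | DInf a _ => a end.

(* The free variables of a rule are schematic: an inference is an instance of
   a rule by terms of the sublanguage. *)
Inductive derivation S R : dtree L -> Prop :=
| der_asm a : atom S a -> derivation S R (DAsm a)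
| der_inf (r : rule L) (s : nat -> term L) ds :
    R r ->
    (forall x, TERM_L (s x) && tm_over S (s x)) ->
    (forall d, List.In d ds -> derivation S R d) ->
    map concl ds = map (sub_fm s) r.1 ->
    derivation S R (DInf (sub_fm s r.2) ds).

Fixpoint assumptions (d : dtree L) : seq (form L) :=
  match d with
  | DAsm a => [:: a]
  | DInf _ ds => flatten (map assumptions ds)
  end.

Fixpoint occurring (d : dtree L) : seq (form L) :=
  match d with
  | DAsm a => [:: a]
  | DInf a ds => a :: flatten (map occurring ds)
  end.

Definition derivable S R (G : seq (form L)) (a : form L) : Prop :=
  exists d, [/\ derivation S R d, concl d = a & {subset assumptions d <= G}].

(* As for a recursively axiomatisable theory: some recursive set of rules has
   the same consequences. *)
Definition recursively_axiomatisable S R : Prop :=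
  exists R0 : rule L -> Prop,
    [/\ forall r, R0 r -> production_rule S r,
        recursive R0 &
        forall G a, derivable S R0 G a <-> derivable S R G a].

End AtomicSystems.

Record atomic_system (L : language) := AtomicSystem {
  as_lang : sublanguage L;
  as_rules : rule L -> Prop;
  as_production : forall r, as_rules r -> production_rule as_lang r;
  as_rec : recursively_axiomatisable as_lang as_rules }.

(* The other two components of a base, the individual and the relational
   constants of L, are determined by L. *)
Record atomic_base (L : language) := AtomicBase {
  base_system : atomic_system L }.

Definition DER (L : language) (B : atomic_base L) (d : dtree L) : Prop :=
  derivation (as_lang (base_system B)) (as_rules (base_system B)) d.

Definition closed_DER (L : language) (B : atomic_base L) (d : dtree L) : Prop :=
  [/\ DER B d, assumptions d = [::] &
      forall a, a \in occurring d -> fv_fm a = [::]].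

(* Occurrence of a typed- or functional variable: free, with its index and its
   type, or bound.  In Fr i a standing for the functional variable h_x^alpha,
   a is the body of alpha with respect to x. *)
Inductive ref (L : language) : Type :=
| Fr of nat & form L
| Bd of nat.
Arguments Fr {L} _ _.
Arguments Bd {L} _.

(* A boolean selects the first (true) or the second (false) component.
   GOrE a b T U Z : U and Z bind a typed-variable, of type a and b.
   GAllE c d T    : the operational type is [c |> d]; so is it for GExI d c T.
   GExE a T U     : U binds an individual and a typed-variable; a is the body
                    of the formula whose existential quantification T has as
                    type. *)
Inductive gterm (L : language) : Type :=
| GCst of dtree L
| GVar of ref L
| GH of ref L & term L
| GF of ref L & gterm L
| GAndI of gterm L & gterm L
| GAndE of bool & gterm L
| GOrI of bool & form L & form L & gterm L
| GOrE of form L & form L & gterm L & gterm L & gterm L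
| GImpI of form L & gterm L
| GImpE of gterm L & gterm L
| GAllI of gterm L
| GAllE of form L & form L & gterm L
| GExI of form L & form L & gterm L
| GExE of form L & gterm L & gterm L
| GBotE of form L & gterm L.

Inductive gvar (L : language) : Type :=
| VI of nat
| VT of nat & form L
| VH of nat & form L
| VF of nat & form L.
Arguments VI {L} _.

Inductive binder (L : language) : Type :=
| BI
| BT of form L
| BH of form L
| BF of form L.
Arguments BI {L}.

(* PQ true is the universal quantifier, PQ false the existential one. *)
Inductive gform (L : language) : Type :=
| PGr of gterm L & form L
| PEqv of gterm L & gterm L
| PBot
| PAnd of gform L & gform L
| POr of gform L & gform L
| PImp of gform L & gform L
| PQ of bool & binder L & gform L.
Arguments PBot {L}.

Section Traversal.
Variable L : language.
Local Notation term := (term L).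
Local Notation form := (form L).
Local Notation ref := (ref L).
Local Notation gterm := (gterm L).
Local Notation gform := (gform L).

(* What to do at free and bound individual variables, typed-variables, h- and
   f-variables; each nat coming first is the number of binders of the relevant
   kind that have been crossed. *)
Record action := Action {
  on_var : nat -> nat -> term;
  on_bnd : nat -> nat -> term;
  on_tvar : nat -> ref -> gterm;
  on_h : nat -> ref -> term -> gterm;
  on_f : nat -> ref -> gterm -> gterm }.

Variable f : action.

Definition act_fm k (a : form) : form := fm_map (on_var f) (on_bnd f) k a.
Definition act_ref k (r : ref) : ref :=
  if r is Fr i a then Fr i (act_fm k a) else r.

Fixpoint act_gt (dh df : nat) (di dt : nat) (T : gterm) : gterm :=
  let rec := act_gt dh df in
  match T with
  | GCst d => GCst d
  | GVar r => on_tvar f dt (act_ref di r)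
  | GH r t => on_h f dh (act_ref di.+1 r) (tm_map (on_var f di) (on_bnd f di) t)
  | GF r T => on_f f df (act_ref di r) (rec di dt T)
  | GAndI T U => GAndI (rec di dt T) (rec di dt U)
  | GAndE b T => GAndE b (rec di dt T)
  | GOrI s a b T => GOrI s (act_fm di a) (act_fm di b) (rec di dt T)
  | GOrE a b T U Z =>
      GOrE (act_fm di a) (act_fm di b)
           (rec di dt T) (rec di dt.+1 U) (rec di dt.+1 Z)
  | GImpI a T => GImpI (act_fm di a) (rec di dt.+1 T)
  | GImpE T U => GImpE (rec di dt T) (rec di dt U)
  | GAllI T => GAllI (rec di.+1 dt T)
  | GAllE c d T => GAllE (act_fm di c) (act_fm di d) (rec di dt T)
  | GExI d c T => GExI (act_fm di d) (act_fm di c) (rec di dt T)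
  | GExE a T U => GExE (act_fm di.+1 a) (rec di dt T) (rec di.+1 dt.+1 U)
  | GBotE a T => GBotE (act_fm di a) (rec di dt T)
  end.

Fixpoint act_gf (dh df di dt : nat) (A : gform) : gform :=
  match A with
  | PGr T a => PGr (act_gt dh df di dt T) (act_fm di a)
  | PEqv T U => PEqv (act_gt dh df di dt T) (act_gt dh df di dt U)
  | PBot => PBot
  | PAnd A B => PAnd (act_gf dh df di dt A) (act_gf dh df di dt B)
  | POr A B => POr (act_gf dh df di dt A) (act_gf dh df di dt B)
  | PImp A B => PImp (act_gf dh df di dt A) (act_gf dh df di dt B)
  | PQ q BI A => PQ q BI (act_gf dh df di.+1 dt A)
  | PQ q (BT a) A => PQ q (BT (act_fm di a)) (act_gf dh df di dt.+1 A)
  | PQ q (BH a) A => PQ q (BH (act_fm di.+1 a)) (act_gf dh.+1 df di dt A)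
  | PQ q (BF a) A => PQ q (BF (act_fm di a)) (act_gf dh df.+1 di dt A)
  end.

Definition act_term (T : gterm) : gterm := act_gt 0 0 0 0 T.
Definition act_form (A : gform) : gform := act_gf 0 0 0 0 A.

End Traversal.

Section Substitution.
Variable L : language.
Local Notation term := (term L).
Local Notation form := (form L).
Local Notation ref := (ref L).
Local Notation gterm := (gterm L).
Local Notation gform := (gform L).

Definition is_Fr (i : nat) (a : form) (r : ref) : bool :=
  if r is Fr j b then (i == j) && (a == b) else false.
Definition is_Bd (k : nat) (r : ref) : bool :=
  if r is Bd j then k == j else false.

Definition keep_tvar (k : nat) (r : ref) : gterm := GVar r.
Definition keep_h (k : nat) (r : ref) (t : term) : gterm := GH r t.
Definition keep_f (k : nat) (r : ref) (T : gterm) : gterm := GF r T.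

Definition close_at (v : gvar L) : action L :=
  match v with
  | VI x => Action (close_var L x) (@keep_bnd L) keep_tvar keep_h keep_f
  | VT i a => Action (@keep_var L) (@keep_bnd L)
      (fun k r => if is_Fr i a r then GVar (Bd k) else GVar r) keep_h keep_f
  | VH i a => Action (@keep_var L) (@keep_bnd L) keep_tvar
      (fun k r t => if is_Fr i a r then GH (Bd k) t else GH r t) keep_f
  | VF i a => Action (@keep_var L) (@keep_bnd L) keep_tvar keep_h
      (fun k r T => if is_Fr i a r then GF (Bd k) T else GF r T)
  end.

Definition open_i (t : term) : action L :=
  Action (@keep_var L) (open_var t) keep_tvar keep_h keep_f.
Definition open_t (W : gterm) : action L :=
  Action (@keep_var L) (@keep_bnd L)
    (fun k r => if is_Bd k r then W else GVar r) keep_h keep_f.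
(* h(t) becomes U(t), where U is a body with respect to the parameter of h. *)
Definition open_h (U : gterm) : action L :=
  Action (@keep_var L) (@keep_bnd L) keep_tvar
    (fun k r t => if is_Bd k r then act_term (open_i t) U else GH r t) keep_f.
(* f(T) becomes U, whatever T is. *)
Definition open_f (U : gterm) : action L :=
  Action (@keep_var L) (@keep_bnd L) keep_tvar keep_h
    (fun k r T => if is_Bd k r then U else GF r T).

Definition close_gt v T := act_term (close_at v) T.
Definition close_gf v A := act_form (close_at v) A.

Definition subI_gt (t : term) (x : nat) T := act_term (open_i t) (close_gt (VI x) T).
Definition subT_gt (W : gterm) i a T := act_term (open_t W) (close_gt (VT i a) T).

Definition subI_gf (t : term) (x : nat) A := act_form (open_i t) (close_gf (VI x) A).
Definition subT_gf (W : gterm) i a A := act_form (open_t W) (close_gf (VT i a) A).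
(* The body of U with respect to x is substituted for the h-variable (i, a). *)
Definition subH_gf (x : nat) (U : gterm) i a A :=
  act_form (open_h (close_gt (VI x) U)) (close_gf (VH i a) A).
Definition subF_gf (U : gterm) i a A := act_form (open_f U) (close_gf (VF i a) A).

Definition xi i (a : form) : gterm := GVar (Fr i a).
Definition happ i (a : form) (t : term) : gterm := GH (Fr i a) t.
Definition fapp i (a : form) (T : gterm) : gterm := GF (Fr i a) T.

Definition orE i a j b (T U Z : gterm) : gterm :=
  GOrE a b T (close_gt (VT i a) U) (close_gt (VT j b) Z).
Definition impI i a (T : gterm) : gterm := GImpI a (close_gt (VT i a) T).
Definition allI x (T : gterm) : gterm := GAllI (close_gt (VI x) T).

(* a is a body; the typed-variable bound in U is the i-th one of type a(y). *)
Definition bind_ex y i (a : form) (U : gterm) : gterm :=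
  close_gt (VI y) (close_gt (VT i (inst_fm (Var y) a)) U).
Definition exE y i a (T U : gterm) : gterm := GExE a T (bind_ex y i a U).

(* U(t, W): t for y and W for the i-th typed-variable of type a(y),
   simultaneously. *)
Definition sub_ex (t : term) (W : gterm) y i a (U : gterm) : gterm :=
  act_term (open_t W) (act_term (open_i t) (bind_ex y i a U)).

Definition binder_of (v : gvar L) : binder L :=
  match v with VI _ => BI | VT _ a => BT a | VH _ a => BH a | VF _ a => BF a end.

Definition quant (q : bool) (v : gvar L) A := PQ q (binder_of v) (close_gf v A).
Definition pAll v A := quant true v A.
Definition pEx v A := quant false v A.

Section Collect.
Variables (X : Type) (cf : form -> seq X) (ct : term -> seq X).
Variables cv ch cF : ref -> seq X.

Fixpoint collect_gt (T : gterm) : seq X :=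
  match T with
  | GCst _ => [::]
  | GVar r => cv r
  | GH r t => ch r ++ ct t
  | GF r T => cF r ++ collect_gt T
  | GAndI T U | GImpE T U => collect_gt T ++ collect_gt U
  | GAndE _ T | GAllI T => collect_gt T
  | GOrI _ a b T | GAllE a b T | GExI a b T => cf a ++ cf b ++ collect_gt T
  | GOrE a b T U Z =>
      cf a ++ cf b ++ collect_gt T ++ collect_gt U ++ collect_gt Z
  | GImpI a T | GBotE a T => cf a ++ collect_gt T
  | GExE a T U => cf a ++ collect_gt T ++ collect_gt U
  end.

Fixpoint collect_gf (A : gform) : seq X :=
  match A with
  | PGr T a => collect_gt T ++ cf a
  | PEqv T U => collect_gt T ++ collect_gt U
  | PBot => [::]
  | PAnd A B | POr A B | PImp A B => collect_gf A ++ collect_gf B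
  | PQ _ BI A => collect_gf A
  | PQ _ (BT a) A | PQ _ (BH a) A | PQ _ (BF a) A => cf a ++ collect_gf A
  end.

End Collect.

Definition nothing (X Y : Type) (y : Y) : seq X := [::].
Definition name (r : ref) : seq (nat * form) :=
  if r is Fr i a then [:: (i, a)] else [::].
Definition ind_vars (r : ref) : seq nat :=
  if r is Fr _ a then fv_fm a else [::].

Definition FVT (T : gterm) : seq (nat * form) :=
  collect_gt (@nothing _ _) (@nothing _ _) name (@nothing _ _) (@nothing _ _) T.

Definition free_in (v : gvar L) (A : gform) : bool :=
  match v with
  | VI x => x \in collect_gf (@fv_fm L) (@fv_tm L) ind_vars ind_vars ind_vars A
  | VT i a => (i, a) \in collect_gf (@nothing _ _) (@nothing _ _)
                           name (@nothing _ _) (@nothing _ _) A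
  | VH i a => (i, a) \in collect_gf (@nothing _ _) (@nothing _ _)
                           (@nothing _ _) name (@nothing _ _) A
  | VF i a => (i, a) \in collect_gf (@nothing _ _) (@nothing _ _)
                           (@nothing _ _) (@nothing _ _) name A
  end.

Definition fresh (v : gvar L) (G : seq gform) : Prop :=
  forall A, List.In A G -> ~~ free_in v A.

End Substitution.

Section Typing.
Variables (L : language) (B : atomic_base L).
Implicit Types (T U Z W : gterm L) (a b c : form L) (A C : gform L).

(* typed false T a: T is a term of Gen of type a;
   typed true T a: T is a term of enriched Gen of type a.
   In ty_exE, the variable that U binds is proper: it may occur in the type of
   no free typed-variable of U but the bound one, also if the types coincide. *)
Inductive typed (e : bool) : gterm L -> form L -> Prop :=
| ty_const d : closed_DER B d -> typed e (GCst d) (concl d)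
| ty_var i a : FORM_L a -> typed e (xi i a) a
| ty_h i a t : e -> wf_fm 1 a -> TERM_L t -> typed e (happ i a t) (inst_fm t a)
| ty_f i a T b : e -> FORM_L a -> typed false T b -> typed e (fapp i a T) a
| ty_andI T U a b :
    typed e T a -> typed e U b -> typed e (GAndI T U) (FAnd a b)
| ty_andE (s : bool) T a b :
    typed e T (FAnd a b) -> typed e (GAndE s T) (if s then a else b)
| ty_orI (s : bool) T a b :
    FORM_L (FOr a b) -> typed e T (if s then a else b) ->
    typed e (GOrI s a b T) (FOr a b)
| ty_orE i j T U Z a b c :
    typed e T (FOr a b) -> typed e U c -> typed e Z c ->
    typed e (orE i a j b T U Z) c
| ty_impI i T a b :
    FORM_L a -> typed e T b -> typed e (impI i a T) (FImp a b)
| ty_impE T U a b :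
    typed e T (FImp a b) -> typed e U a -> typed e (GImpE T U) b
| ty_allI x T a :
    typed e T a -> (forall p, p \in FVT T -> x \notin fv_fm p.2) ->
    typed e (allI x T) (fAll x a)
| ty_allE T a t :
    typed e T (FAll a) -> TERM_L t ->
    typed e (GAllE (FAll a) (inst_fm t a) T) (inst_fm t a)
| ty_exI T a t :
    wf_fm 1 a -> TERM_L t -> typed e T (inst_fm t a) ->
    typed e (GExI (inst_fm t a) (FEx a) T) (FEx a)
| ty_exE y i T U a b :
    typed e T (FEx a) -> typed e U b ->
    y \notin fv_fm (FEx a) -> y \notin fv_fm b ->
    (forall p, p \in FVT U -> p != (i, inst_fm (Var y) a) ->
       y \notin fv_fm p.2) ->
    typed e (exE y i a T U) b
| ty_botE T a : FORM_L a -> typed e T FBot -> typed e (GBotE a T) a.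

Definition TERM_Gen T a := typed false T a.

Definition wf_var (v : gvar L) : bool :=
  match v with
  | VI _ => true
  | VT _ a | VF _ a => FORM_L a
  | VH _ a => wf_fm 1 a
  end.

Inductive wf_gf : gform L -> Prop :=
| wf_Gr T a : typed true T a -> wf_gf (PGr T a)
| wf_Eqv T U a : typed true T a -> typed true U a -> wf_gf (PEqv T U)
| wf_Bot : wf_gf PBot
| wf_And A C : wf_gf A -> wf_gf C -> wf_gf (PAnd A C)
| wf_Or A C : wf_gf A -> wf_gf C -> wf_gf (POr A C)
| wf_Imp A C : wf_gf A -> wf_gf C -> wf_gf (PImp A C)
| wf_Q q v A : wf_var v -> wf_gf A -> wf_gf (quant q v A).

(* instance v A A': A' is A with an admissible term substituted for v, or A
   itself. *)
Inductive instance : gvar L -> gform L -> gform L -> Prop :=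
| inst_self v A : instance v A A
| inst_I x t A : TERM_L t -> instance (VI x) A (subI_gf t x A)
| inst_T i a W A : TERM_Gen W a -> instance (VT i a) A (subT_gf W i a A)
| inst_F i a W A : TERM_Gen W a -> instance (VF i a) A (subF_gf W i a A)
| inst_H i a x W A :
    x \notin fv_fm a -> TERM_Gen W (inst_fm (Var x) a) ->
    (forall p, p \in FVT W -> x \notin fv_fm p.2) ->
    instance (VH i a) A (subH_gf x W i a A).

(* GG G A: A is derivable with all its undischarged assumptions in G.  As GG is
   closed under weakening, side conditions constrain only the assumptions that
   are actually used; rules restricting the assumptions of only some of their
   premises have separate contexts.  The premises wf_gf, FORM_L, ... make sure
   that only formulas of enriched Gen are derived.  Since bound variables have
   no name, in GG_allI the bound variable need not be renamed. *)
Inductive GG : seq (gform L) -> gform L -> Prop :=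
| GG_asm G A : wf_gf A -> List.In A G -> GG G A
| GG_weak G G' A : List.incl G G' -> GG G A -> GG G' A

| GG_const G d : closed_DER B d -> GG G (PGr (GCst d) (concl d))
| GG_andI G T U a b :
    GG G (PGr T a) -> GG G (PGr U b) -> GG G (PGr (GAndI T U) (FAnd a b))
| GG_orI G (s : bool) T a b :
    wf_gf (PGr (GOrI s a b T) (FOr a b)) ->
    GG G (PGr T (if s then a else b)) ->
    GG G (PGr (GOrI s a b T) (FOr a b))
| GG_impI G i T a b :
    FORM_L a -> GG (PGr (xi i a) a :: G) (PGr T b) -> fresh (VT i a) G ->
    GG G (PGr (impI i a T) (FImp a b))
| GG_allI G x T a :
    wf_gf (PGr (allI x T) (fAll x a)) ->
    GG G (PGr T a) -> fresh (VI x) G ->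
    GG G (PGr (allI x T) (fAll x a))
| GG_exI G t T a :
    wf_fm 1 a -> TERM_L t -> GG G (PGr T (inst_fm t a)) ->
    GG G (PGr (GExI (inst_fm t a) (FEx a) T) (FEx a))

| GG_Dand G G1 i j T a b A :
    GG G (PGr T (FAnd a b)) ->
    GG [:: PEqv T (GAndI (xi i a) (xi j b)), PGr (xi i a) a, PGr (xi j b) b & G1]
       A ->
    (i, a) != (j, b) ->
    fresh (VT i a) (A :: G1) -> fresh (VT j b) (A :: G1) ->
    GG (G ++ G1) A
| GG_Dor G G1 G2 i j T a b A :
    GG G (PGr T (FOr a b)) ->
    GG [:: PEqv T (GOrI true a b (xi i a)), PGr (xi i a) a & G1] A ->
    GG [:: PEqv T (GOrI false a b (xi j b)), PGr (xi j b) b & G2] A ->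
    fresh (VT i a) (A :: G1) -> fresh (VT j b) (A :: G2) ->
    GG (G ++ G1 ++ G2) A
| GG_Dimp G G1 i k T a b A :
    GG G (PGr T (FImp a b)) ->
    GG [:: PEqv T (impI i a (fapp k b (xi i a))),
           pAll (VT i a)
             (PImp (PGr (xi i a) a) (PGr (fapp k b (xi i a)) b)) & G1] A ->
    fresh (VF k b) (A :: G1) ->
    GG (G ++ G1) A
| GG_Dall G G1 x k T a A :
    GG G (PGr T (FAll a)) ->
    x \notin fv_fm (FAll a) ->
    GG [:: PEqv T (allI x (happ k a (Var x))),
           pAll (VI x)
             (PGr (happ k a (Var x)) (inst_fm (Var x) a)) & G1] A ->
    fresh (VH k a) (A :: G1) ->
    GG (G ++ G1) A
| GG_Dex G G1 x i T a A :
    GG G (PGr T (FEx a)) ->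
    x \notin fv_fm (FEx a) ->
    let ax := inst_fm (Var x) a in
    GG [:: PEqv T (GExI ax (FEx a) (xi i ax)), PGr (xi i ax) ax & G1] A ->
    fresh (VI x) (A :: G1) -> fresh (VT i ax) (A :: G1) ->
    GG (G ++ G1) A
| GG_bot G T : GG G (PGr T FBot) -> GG G PBot

| GG_refl G T : wf_gf (PEqv T T) -> GG G (PEqv T T)
| GG_sym G T U : GG G (PEqv T U) -> GG G (PEqv U T)
| GG_trans G T U Z : GG G (PEqv T U) -> GG G (PEqv U Z) -> GG G (PEqv T Z)
| GG_pres G T U a : GG G (PEqv T U) -> GG G (PGr U a) -> GG G (PGr T a)

| GG_c_andI G T T' U U' :
    GG G (PEqv T T') -> GG G (PEqv U U') ->
    GG G (PEqv (GAndI T U) (GAndI T' U'))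
| GG_c_andE G s T T' :
    wf_gf (PEqv (GAndE s T) (GAndE s T')) ->
    GG G (PEqv T T') -> GG G (PEqv (GAndE s T) (GAndE s T'))
| GG_c_orI G s a b T T' :
    wf_gf (PEqv (GOrI s a b T) (GOrI s a b T')) ->
    GG G (PEqv T T') -> GG G (PEqv (GOrI s a b T) (GOrI s a b T'))
| GG_c_orE G i a j b T T' U U' Z Z' :
    wf_gf (PEqv (orE i a j b T U Z) (orE i a j b T' U' Z')) ->
    GG G (PEqv T T') -> GG G (PEqv U U') -> GG G (PEqv Z Z') ->
    GG G (PEqv (orE i a j b T U Z) (orE i a j b T' U' Z'))
| GG_c_impI G i a T T' :
    FORM_L a ->
    GG G (PEqv T T') -> GG G (PEqv (impI i a T) (impI i a T'))
| GG_c_impE G T T' U U' :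
    wf_gf (PEqv (GImpE T U) (GImpE T' U')) ->
    GG G (PEqv T T') -> GG G (PEqv U U') ->
    GG G (PEqv (GImpE T U) (GImpE T' U'))
| GG_c_allI G x T T' :
    wf_gf (PEqv (allI x T) (allI x T')) ->
    GG G (PEqv T T') -> GG G (PEqv (allI x T) (allI x T'))
| GG_c_allE G c d T T' :
    wf_gf (PEqv (GAllE c d T) (GAllE c d T')) ->
    GG G (PEqv T T') -> GG G (PEqv (GAllE c d T) (GAllE c d T'))
| GG_c_exI G d c T T' :
    wf_gf (PEqv (GExI d c T) (GExI d c T')) ->
    GG G (PEqv T T') -> GG G (PEqv (GExI d c T) (GExI d c T'))
| GG_c_exE G y i a T T' U U' :
    wf_gf (PEqv (exE y i a T U) (exE y i a T' U')) ->
    GG G (PEqv T T') -> GG G (PEqv U U') ->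
    GG G (PEqv (exE y i a T U) (exE y i a T' U'))

| GG_i_andI1 G T T' U U' :
    GG G (PEqv (GAndI T U) (GAndI T' U')) -> GG G (PEqv T T')
| GG_i_andI2 G T T' U U' :
    GG G (PEqv (GAndI T U) (GAndI T' U')) -> GG G (PEqv U U')
| GG_i_orI G s a b T T' :
    GG G (PEqv (GOrI s a b T) (GOrI s a b T')) -> GG G (PEqv T T')
| GG_i_impI G i a T T' :
    wf_gf (PEqv T T') ->
    GG G (PEqv (impI i a T) (impI i a T')) -> GG G (PEqv T T')
| GG_i_allI G x T T' :
    wf_gf (PEqv T T') ->
    GG G (PEqv (allI x T) (allI x T')) -> GG G (PEqv T T')
| GG_i_exI G d c T T' :
    GG G (PEqv (GExI d c T) (GExI d c T')) -> GG G (PEqv T T')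

| GG_e_and G (s : bool) T U :
    let E := PEqv (GAndE s (GAndI T U)) (if s then T else U) in
    wf_gf E -> GG G E
| GG_e_or G (s : bool) i a j b T U Z :
    let E := PEqv (orE i a j b (GOrI s a b T) U Z)
                  (if s then subT_gt T i a U else subT_gt T j b Z) in
    TERM_Gen T (if s then a else b) ->
    wf_gf E -> GG G E
| GG_e_imp G i a T U :
    let E := PEqv (GImpE (impI i a T) U) (subT_gt U i a T) in
    TERM_Gen U a -> wf_gf E -> GG G E
| GG_e_all G x a t T :
    let b := fAll x a in
    let E := PEqv (GAllE b (inst_fm t (bind_fm x a)) (allI x T)) (subI_gt t x T) in
    TERM_L t -> wf_gf E -> GG G E
| GG_e_ex G y i a t T U :
    let E := PEqv (exE y i a (GExI (inst_fm t a) (FEx a) T) U)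
                  (sub_ex t T y i a U) in
    TERM_L t -> TERM_Gen T (inst_fm t a) -> wf_gf E -> GG G E

| GG_AndI G A C : GG G A -> GG G C -> GG G (PAnd A C)
| GG_AndE1 G A C : GG G (PAnd A C) -> GG G A
| GG_AndE2 G A C : GG G (PAnd A C) -> GG G C
| GG_OrI1 G A C : wf_gf C -> GG G A -> GG G (POr A C)
| GG_OrI2 G A C : wf_gf A -> GG G C -> GG G (POr A C)
| GG_OrE G A C D :
    GG G (POr A C) -> GG (A :: G) D -> GG (C :: G) D -> GG G D
| GG_ImpI G A C : wf_gf A -> GG (A :: G) C -> GG G (PImp A C)
| GG_ImpE G A C : GG G (PImp A C) -> GG G A -> GG G C
| GG_AllI G v A : wf_var v -> GG G A -> fresh v G -> GG G (pAll v A)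
| GG_AllE G v A A' : wf_gf A -> GG G (pAll v A) -> instance v A A' -> GG G A'
| GG_ExI G v A A' :
    wf_var v -> wf_gf A -> instance v A A' -> GG G A' -> GG G (pEx v A)
| GG_ExE G G1 v A C :
    wf_gf A -> GG G (pEx v A) -> GG (A :: G1) C -> fresh v (C :: G1) ->
    GG (G ++ G1) C
| GG_BotE G A : wf_gf A -> GG G PBot -> GG G A.

End Typing.

(* Main.v *)
(* Induction on the construction of U.  For an eliminating symbol, the D-rule of
   its connective gives the major argument T a canonical form; by congruence
   and the equation of the symbol, U is equivalent to a term whose typing is
   known, and typing is preserved by equivalence.  Substituting a term for a
   typed-variable within a derivation is simulated by introducing and
   eliminating an implication under a quantifier, so that no substitution lemma
   for GG is needed.  For disjunction, the proper variables of the D-rule have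
   to be renamed apart from the variables bound in U; that renaming preserves
   typing holds because typing is invariant under permutations of the indices
   of typed-variables. *)
Require Import Defs.
From mathcomp Require Import all_boot.

Set Implicit Arguments.
Unset Strict Implicit.
Unset Printing Implicit Defensive.

(** * First-order terms and formulas: opening, closing and well-formedness *)

Section FirstOrder.
Variable L : language.
Implicit Types (t : term L) (a : form L) (x k : nat).

(** Membership instead of positions in the list of arguments: the form that [eq_in_map] and [allP]
    can use. *)
Lemma term_mem_ind (P : term L -> Prop) :
  (forall x, P (Var x)) -> (forall j, P (Bnd j)) -> (forall c, P (Cst c)) ->
  (forall f ts, (forall t, t \in ts -> P t) -> P (App f ts)) ->
  forall t, P t.
Proof.
move=> hV hB hC hA; apply: term_rect' => // f ts IH; apply: hA => t.
by case/(nthP (Var 0)) => i _ <-.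
Qed.

Lemma tm_map_id k t : tm_map (@keep_var L k) (@keep_bnd L k) t = t.
Proof.
elim/term_mem_ind: t => //= f ts IH; congr App.
by rewrite -[RHS]map_id; apply/eq_in_map.
Qed.

Lemma fm_map_id k a : fm_map (@keep_var L) (@keep_bnd L) k a = a.
Proof.
elim: a k => //= [r ts|a IHa b IHb|a IHa b IHb|a IHa b IHb|a IHa|a IHa] k;
  rewrite ?IHa ?IHb //.
by congr FRel; rewrite -[RHS]map_id; apply/eq_map => t; rewrite tm_map_id.
Qed.

Lemma lift_tm0 t : lift_tm 0 t = t.
Proof.
rewrite /lift_tm; elim/term_mem_ind: t => //= [j|f ts IH];
  first by rewrite addn0.
by congr App; rewrite -[RHS]map_id; apply/eq_in_map.
Qed.

Lemma tm_close_fresh x k t :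
  x \notin fv_tm t -> tm_map (close_var L x k) (@keep_bnd L k) t = t.
Proof.
elim/term_mem_ind: t => //= [y|f ts IH].
  by rewrite inE eq_sym /close_var => /negbTE ->.
move=> /flatten_mapP hx; congr App; rewrite -[RHS]map_id.
apply/eq_in_map => t ht.
by apply: IH => //; apply/negP => hxt; apply: hx; exists t.
Qed.

Lemma fm_close_fresh x k a :
  x \notin fv_fm a -> fm_map (close_var L x) (@keep_bnd L) k a = a.
Proof.
elim: a k => //= [r ts|a IHa b IHb|a IHa b IHb|a IHa b IHb|a IHa|a IHa] k;
  rewrite ?mem_cat ?negb_or;
  try by [case/andP => /IHa -> /IHb -> | move/IHa ->].
move=> /flatten_mapP hx; congr FRel; rewrite -[RHS]map_id.
apply/eq_in_map => t ht.
by apply: tm_close_fresh; apply/negP => hxt; apply: hx; exists t.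
Qed.

Lemma notin_fv_tm_close x k t :
  x \notin fv_tm (tm_map (close_var L x k) (@keep_bnd L k) t).
Proof.
elim/term_mem_ind: t => //= [y|f ts IH].
  by rewrite /close_var; case: eqP => //= /eqP; rewrite inE eq_sym.
by apply/flatten_mapP => -[_ /mapP[t ht ->]]; apply/negP/IH.
Qed.

Lemma notin_fv_fm_close x k a :
  x \notin fv_fm (fm_map (close_var L x) (@keep_bnd L) k a).
Proof.
elim: a k => //= [r ts|a IHa b IHb|a IHa b IHb|a IHa b IHb] k;
  rewrite ?mem_cat ?negb_or ?IHa ?IHb //.
by apply/flatten_mapP => -[_ /mapP[t ht ->]]; apply/negP/notin_fv_tm_close.
Qed.

Lemma tm_open_wf t k u :
  wf_tm k u -> tm_map (@keep_var L k) (open_var t k) u = u.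
Proof.
elim/term_mem_ind: u => //= [j|f ts IH].
  by rewrite /open_var; case: eqP => // ->; rewrite ltnn.
case/andP => _ /allP h; congr App; rewrite -[RHS]map_id.
by apply/eq_in_map => u hu; apply/IH/h.
Qed.

Lemma fm_open_wf t k a :
  wf_fm k a -> fm_map (@keep_var L) (open_var t) k a = a.
Proof.
elim: a k => //= [r ts|a IHa b IHb|a IHa b IHb|a IHa b IHb|a IHa|a IHa] k;

  try by [case/andP => /IHa -> /IHb -> | move/IHa ->].
case/andP => _ /allP h; congr FRel; rewrite -[RHS]map_id.
by apply/eq_in_map => u hu; apply/tm_open_wf/h.
Qed.

(** The bound on dangling indices ensures that opening meets only the index [k] that closing
    introduced. *)
Lemma tm_closeK x k t : wf_tm k t ->
  tm_map (@keep_var L k) (open_var (Var x) k)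
    (tm_map (close_var L x k) (@keep_bnd L k) t) = t.
Proof.
elim/term_mem_ind: t => //= [y|j|f ts IH].
- by rewrite /close_var; case: eqP => //= ->; rewrite /open_var eqxx.
- by rewrite /open_var; case: eqP => // ->; rewrite ltnn.
case/andP => _ /allP h; congr App; rewrite -map_comp -[RHS]map_id.
by apply/eq_in_map => u hu; apply/IH/h.
Qed.

Lemma fm_closeK x k a : wf_fm k a ->
  fm_map (@keep_var L) (open_var (Var x)) k
    (fm_map (close_var L x) (@keep_bnd L) k a) = a.
Proof.
elim: a k => //= [r ts|a IHa b IHb|a IHa b IHb|a IHa b IHb|a IHa|a IHa] k;

  try by [case/andP => /IHa -> /IHb -> | move/IHa ->].
case/andP => _ /allP h; congr FRel; rewrite -map_comp -[RHS]map_id.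
by apply/eq_in_map => u hu; apply/tm_closeK/h.
Qed.

(** Freshness ensures that closing captures only the [x] that opening introduced. *)
Lemma tm_openK x k t : x \notin fv_tm t ->
  tm_map (close_var L x k) (@keep_bnd L k)
    (tm_map (@keep_var L k) (open_var (Var x) k) t) = t.
Proof.
elim/term_mem_ind: t => //= [y|j|f ts IH].
- by rewrite inE eq_sym /close_var => /negbTE ->.
- by rewrite /open_var; case: eqP => // -> /=; rewrite /close_var eqxx.
move=> /flatten_mapP hx; congr App; rewrite -map_comp -[RHS]map_id.
by apply/eq_in_map => t ht; apply: IH => //; apply/negP => ?; apply: hx; exists t.
Qed.

Lemma fm_openK x k a : x \notin fv_fm a ->
  fm_map (close_var L x) (@keep_bnd L) k
    (fm_map (@keep_var L) (open_var (Var x)) k a) = a.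
Proof.
elim: a k => //= [r ts|a IHa b IHb|a IHa b IHb|a IHa b IHb|a IHa|a IHa] k;
  rewrite ?mem_cat ?negb_or;
  try by [case/andP => /IHa -> /IHb -> | move/IHa ->].
move=> /flatten_mapP hx; congr FRel; rewrite -map_comp -[RHS]map_id.
by apply/eq_in_map => t ht; apply: tm_openK; apply/negP => ?; apply: hx; exists t.
Qed.

Lemma bind_inst x a : x \notin fv_fm a -> bind_fm x (inst_fm (Var x) a) = a.
Proof. exact: fm_openK. Qed.

Lemma wf_tm_weak k m t : k <= m -> wf_tm k t -> wf_tm m t.
Proof.
move=> km; elim/term_mem_ind: t => //= [j jk|f ts IH].
  exact: leq_trans km.
by case/andP => -> /allP h /=; apply/allP => u hu; apply/IH/h.
Qed.

Lemma wf_tm_map fv fb k m t :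
  (forall x, wf_tm m (fv x)) -> (forall j, j < k -> wf_tm m (fb j)) ->
  wf_tm k t -> wf_tm m (@tm_map L fv fb t).
Proof.
move=> hv hb; elim/term_mem_ind: t => //= f ts IH /andP[/eqP <- /allP h].
by rewrite size_map eqxx all_map; apply/allP => u hu; apply/IH/h.
Qed.

Lemma wf_fm_map fv fb d k m a :
  (forall n x, wf_tm (n + m) (fv (n + d) x)) ->
  (forall n j, j < n + k -> wf_tm (n + m) (fb (n + d) j)) ->
  wf_fm k a -> wf_fm m (@fm_map L fv fb d a).
Proof.
move=> hv hb.
(* The depth [d] and the bounds [k] and [m] all grow by one under a quantifier, so the induction
   runs over a common offset [n]. *)
have: forall n, wf_fm (n + k) a -> wf_fm (n + m) (fm_map fv fb (n + d) a).
  elim: a => //= [r ts|a IHa b IHb|a IHa b IHb|a IHa b IHb|a IHa|a IHa] n;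
    try by [case/andP => /IHa -> /IHb -> | move/(IHa n.+1)].
  case/andP => /eqP <- /allP h; rewrite size_map eqxx all_map.
  by apply/allP => u hu /=; apply: wf_tm_map (h _ hu); [exact: hv | exact: hb].
by move=> h; exact: (h 0).
Qed.

Lemma wf_close x k a :
  wf_fm k a -> wf_fm k.+1 (fm_map (close_var L x) (@keep_bnd L) k a).
Proof.
apply: wf_fm_map => n j /=; last by rewrite addnS; apply: ltnW.
by rewrite /close_var; case: eqP => //= _; rewrite addnS.
Qed.

Lemma wf_open t k a :
  TERM_L t -> wf_fm k.+1 a -> wf_fm k (fm_map (@keep_var L) (open_var t) k a).
Proof.
move=> ht; apply: wf_fm_map => // n j hj; rewrite /open_var.
case: eqP => [_|/eqP ne] /=; last first.
  by rewrite addnS ltnS leq_eqVlt (negbTE ne) in hj *.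
by apply: wf_tm_map ht.
Qed.

Lemma wf_inst t a : TERM_L t -> wf_fm 1 a -> FORM_L (inst_fm t a).
Proof. exact: wf_open. Qed.

Lemma wf_sub s a : (forall x, TERM_L (s x)) -> FORM_L a -> FORM_L (sub_fm s a).
Proof. by move=> hs; apply: wf_fm_map => // n x; apply: wf_tm_weak (hs x). Qed.

End FirstOrder.

(** * Terms of [Gen]: free typed-variables, substitution and renaming *)

Section GenTerms.
Variable L : language.
Implicit Types (T U V W : gterm L) (a b : form L) (p : nat * form L).

Ltac mem_cat_auto :=
  match goal with
  | IH : _ -> _ |- _ => apply: IH
  end;
  let p := fresh in let hp := fresh in move=> p hp;
  match goal with
  | h : _ -> _ |- _ => apply: h; rewrite ?mem_cat ?hp ?orbT //
  end.

Lemma act_fm_id f k a :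
  on_var f = @keep_var L -> on_bnd f = @keep_bnd L -> act_fm f k a = a.
Proof. by rewrite /act_fm => -> ->; exact: fm_map_id. Qed.

Lemma act_ref_id f k (r : ref L) :
  on_var f = @keep_var L -> on_bnd f = @keep_bnd L -> act_ref f k r = r.
Proof. by case: r => //= i a hv hb; rewrite act_fm_id. Qed.

Lemma FVT_close_t i a T dh df di dt :
  FVT (act_gt (close_at (VT i a)) dh df di dt T) = [seq p <- FVT T | p != (i, a)].
Proof.
rewrite /FVT; elim: T di dt => //=; do ?[
  by move=> *; rewrite ?filter_cat; congruence].
move=> [j b|k] di dt //=; rewrite act_fm_id // xpair_eqE.
by rewrite (eq_sym j) (eq_sym b); case: ifP.
Qed.

(** Closing over an individual variable also acts on the types of typed-variables; these types, and
    with them the names in [FVT], stay the same when [x] does not occur in them. *)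
Lemma FVT_close_i x T dh df di dt :
  (forall p, p \in FVT T -> x \notin fv_fm p.2) ->
  FVT (act_gt (close_at (VI x)) dh df di dt T) = FVT T.
Proof.
rewrite /FVT; elim: T di dt => //=.
- move=> [j b|k] di dt //= h; rewrite /act_fm fm_close_fresh //.
  by apply: (h (j, b)); rewrite inE.
all: move=> *; do ?[congr (_ ++ _)]; mem_cat_auto.
Qed.

(** Closing reaches types and operational types at every depth. This will make the variable bound by
    [exE] fresh for the resulting term. *)
Lemma notin_close_i x T dh df di dt :
  x \notin collect_gt (@fv_fm L) (@fv_tm L)
    (@ind_vars L) (@ind_vars L) (@ind_vars L)
    (act_gt (close_at (VI x)) dh df di dt T).
Proof.
have hr k (r : ref L) : x \notin ind_vars (act_ref (close_at (VI x)) k r).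
  by case: r => // i a; exact: notin_fv_fm_close.
elim: T di dt => //= *;
  rewrite ?mem_cat ?negb_or; do ?[apply/andP; split];
  by rewrite ?notin_fv_fm_close ?notin_fv_tm_close ?hr.
Qed.

(* Terms of Gen proper (no functional variables) whose dangling indices are
   below di and dt respectively. *)
Fixpoint lc (di dt : nat) T : bool :=
  match T with
  | GCst _ => true
  | GVar (Fr _ a) => wf_fm di a
  | GVar (Bd k) => k < dt
  | GH _ _ | GF _ _ => false
  | GAndI T U | GImpE T U => lc di dt T && lc di dt U
  | GAndE _ T => lc di dt T
  | GOrI _ a b T | GAllE a b T | GExI a b T =>
      [&& wf_fm di a, wf_fm di b & lc di dt T]
  | GOrE a b T U Z =>
      [&& wf_fm di a, wf_fm di b, lc di dt T, lc di dt.+1 U & lc di dt.+1 Z]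
  | GImpI a T => wf_fm di a && lc di dt.+1 T
  | GAllI T => lc di.+1 dt T
  | GExE a T U => [&& wf_fm di.+1 a, lc di dt T & lc di.+1 dt.+1 U]
  | GBotE a T => wf_fm di a && lc di dt T
  end.

Ltac split_andb := repeat match goal with
  | H : is_true (_ && _) |- _ => case/andP: H => *
  end.

Lemma lc_close_t i a T dh df di dt :
  lc di dt T -> lc di dt.+1 (act_gt (close_at (VT i a)) dh df di dt T).
Proof.
elim: T di dt => //=;
  try by move=> *; split_andb; rewrite ?act_fm_id //;
  repeat (apply/andP; split); auto.
move=> [j b|k] di dt //=; last exact: ltnW.
by rewrite act_fm_id //; case: ifP => //=; rewrite ltnS.
Qed.

Lemma lc_close_i x T dh df di dt n :
  lc di n T -> lc di.+1 n (act_gt (close_at (VI x)) dh df di dt T).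
Proof.
elim: T di dt n => //=; try by move=> *; split_andb;
  repeat (apply/andP; split); rewrite ?wf_close; auto.
by move=> [j b|k] di dt n //=; exact: wf_close.
Qed.

Lemma gt_closeK_i x T dh df di dt n : lc di n T ->
  act_gt (open_i (Var x)) dh df di dt (act_gt (close_at (VI x)) dh df di dt T) = T.
Proof.
elim: T di dt n => //=;
  try by move=> *; split_andb; rewrite /act_fm ?fm_closeK //; f_equal; eauto.
by move=> [j b|k] di dt n //= h; rewrite /act_fm fm_closeK.
Qed.

(** [lc] excludes [GH] and [GF]. Hence any index is fresh for the functional variables of [GG_Dimp]
    and [GG_Dall]. *)
Lemma lc_no_fun X (ch cF : ref L -> seq X) di dt T : lc di dt T ->
  collect_gt (@nothing _ _) (@nothing _ _) (@nothing _ _) ch cF T = [::].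
Proof.
elim: T di dt => //=; move=> *; split_andb;
  repeat match goal with IH : forall di dt, _ -> _ = [::] |- _ =>
    erewrite IH; [clear IH | eassumption] end; done.
Qed.

(** Substitution in one pass, which spares later inductions the intermediate term with a dangling
    index. *)
Definition subst_t W i a : action L :=
  Action (@keep_var L) (@keep_bnd L)
    (fun k r => if is_Fr i a r then W else GVar r) (@keep_h L) (@keep_f L).

Lemma open_close_t W i a T dh df di dt : lc di dt T ->
  act_gt (open_t W) dh df di dt (act_gt (close_at (VT i a)) dh df di dt T) =
  act_gt (subst_t W i a) dh df di dt T.
Proof.
elim: T di dt => //=;
  try by move=> *; split_andb; rewrite ?act_fm_id //; f_equal; auto.
move=> [j b|k] di dt //=; last by move=> h; rewrite gtn_eqF.
by move=> _; rewrite !act_fm_id //; case: ifP => //= _; rewrite ?eqxx ?act_fm_id.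
Qed.

(** The hypothesis covers both a variable that is not free and the replacement of a variable by
    itself. *)
Lemma subst_t_id W i a T dh df di dt :
  ((i, a) \in FVT T -> W = xi i a) -> act_gt (subst_t W i a) dh df di dt T = T.
Proof.
rewrite /FVT; elim: T di dt => //=;
  try by move=> *; rewrite /keep_h ?act_fm_id ?act_ref_id //; f_equal; auto using tm_map_id.
- move=> [j b|n] di dt //=; rewrite !act_fm_id // inE xpair_eqE.
  by case: ifP => //= /andP[/eqP <- /eqP <-]; apply.
all: move=> *; rewrite /keep_f ?act_fm_id ?act_ref_id //; f_equal;
  match goal with IH : _ -> _ |- _ => apply: IH end => hp;
  match goal with h : _ -> _ |- _ => by apply: h; rewrite ?mem_cat ?hp ?orbT end.
Qed.

(* The new index of a typed-variable depends on the old one and on its type. *)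
Definition ren (s : nat -> form L -> nat) : action L :=
  Action (@keep_var L) (@keep_bnd L)
    (fun k r => GVar (if r is Fr i a then Fr (s i a) a else r))
    (@keep_h L) (@keep_f L).

Lemma subst_t_ren s i a T dh df di dt :
  (forall p, p \in FVT T -> p != (i, a) -> s p.1 p.2 = p.1) ->
  act_gt (subst_t (xi (s i a) a) i a) dh df di dt T = act_gt (ren s) dh df di dt T.
Proof.
rewrite /FVT; elim: T di dt => //=;
  try by move=> *; rewrite ?act_fm_id //; f_equal; auto.
- move=> [j b|n] di dt //=; rewrite !act_fm_id // => h.
  case: ifP => [/andP[/eqP <- /eqP <-] //|/negbT ne].
  have /= -> // := h (j, b); first by rewrite inE.
  by rewrite xpair_eqE (eq_sym j) (eq_sym b).
all: move=> *; rewrite ?act_fm_id //; f_equal; mem_cat_auto.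
Qed.

Lemma FVT_ren s T dh df di dt :
  FVT (act_gt (ren s) dh df di dt T) = [seq (s p.1 p.2, p.2) | p <- FVT T].
Proof.
rewrite /FVT; elim: T di dt => //=; do ?[
  by move=> *; rewrite ?map_cat; congruence].
by move=> [j b|n] di dt //=; rewrite act_fm_id.
Qed.

(** [ren] ignores the depth counters, so the body of a binder can be renamed at depth 0, where
    induction hypotheses about [act_term] apply. *)
Lemma ren_depth s T dh df di dt di' dt' :
  act_gt (ren s) dh df di dt T = act_gt (ren s) dh df di' dt' T.
Proof.
elim: T di dt di' dt' => //=;
  try by move=> *; rewrite ?act_fm_id ?act_ref_id //;
  f_equal; auto using tm_map_id.
Qed.

(** Injectivity at type [a] prevents the renamed binder from capturing a further variable. *)
Lemma ren_close_t s i a T dh df di dt : injective (s^~ a) ->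
  act_gt (ren s) dh df di dt (act_gt (close_at (VT i a)) dh df di dt T) =
  act_gt (close_at (VT (s i a) a)) dh df di dt (act_gt (ren s) dh df di dt T).
Proof.
move=> inj; elim: T di dt => //=;
  try by move=> *; rewrite ?act_fm_id ?act_ref_id //; f_equal; auto.
move=> [j b|n] di dt //=; rewrite !act_fm_id //.
case: (eqVneq a b) => [<-|ne]; last by rewrite !andbF /= act_fm_id.
by rewrite !andbT (inj_eq inj); case: ifP => //= _; rewrite act_fm_id.
Qed.

Lemma ren_close_i s x T dh df di dt :
  (forall p, p \in FVT T -> x \notin fv_fm p.2) ->
  act_gt (ren s) dh df di dt (act_gt (close_at (VI x)) dh df di dt T) =
  act_gt (close_at (VI x)) dh df di dt (act_gt (ren s) dh df di dt T).
Proof.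
rewrite /FVT; elim: T di dt => //=;
  try by move=> *; rewrite /act_fm !fm_map_id; f_equal; auto.
- move=> [j b|n] di dt //= h; rewrite /act_fm !fm_map_id fm_close_fresh //.
  by apply: (h (j, b)); rewrite inE.
- move=> [j b|n] t di dt //= h; rewrite /act_fm ?fm_map_id ?tm_map_id //.
all: move=> *; rewrite ?(@act_ref_id (ren s)) // /act_fm ?fm_map_id; f_equal; mem_cat_auto.
Qed.

End GenTerms.

(** * Typing: well-formedness, local closure and invariance under renaming *)

Section Typing.
Variables (L : language) (B : atomic_base L).
Implicit Types (T U V W : gterm L) (a b c : form L).

(* The Boolean of typed is an index, because of ty_f; at false, induction is
   restored here without the cases of functional variables. *)
Lemma TERM_Gen_ind (P : gterm L -> form L -> Prop) :
  (forall d, closed_DER B d -> P (GCst d) (concl d)) ->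
  (forall i a, FORM_L a -> P (xi i a) a) ->
  (forall T U a b, TERM_Gen B T a -> P T a -> TERM_Gen B U b -> P U b ->
    P (GAndI T U) (FAnd a b)) ->
  (forall s T a b, TERM_Gen B T (FAnd a b) -> P T (FAnd a b) ->
    P (GAndE s T) (if s then a else b)) ->
  (forall (s : bool) T a b, FORM_L (FOr a b) ->
    TERM_Gen B T (if s then a else b) -> P T (if s then a else b) ->
    P (GOrI s a b T) (FOr a b)) ->
  (forall i j T U V a b c, TERM_Gen B T (FOr a b) -> P T (FOr a b) ->
    TERM_Gen B U c -> P U c -> TERM_Gen B V c -> P V c ->
    P (orE i a j b T U V) c) ->
  (forall i T a b, FORM_L a -> TERM_Gen B T b -> P T b ->
    P (impI i a T) (FImp a b)) ->
  (forall T U a b, TERM_Gen B T (FImp a b) -> P T (FImp a b) ->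
    TERM_Gen B U a -> P U a -> P (GImpE T U) b) ->
  (forall x T a, TERM_Gen B T a -> P T a ->
    (forall p, p \in FVT T -> x \notin fv_fm p.2) ->
    P (allI x T) (fAll x a)) ->
  (forall T a t, TERM_Gen B T (FAll a) -> P T (FAll a) -> TERM_L t ->
    P (GAllE (FAll a) (inst_fm t a) T) (inst_fm t a)) ->
  (forall T a t, wf_fm 1 a -> TERM_L t -> TERM_Gen B T (inst_fm t a) ->
    P T (inst_fm t a) -> P (GExI (inst_fm t a) (FEx a) T) (FEx a)) ->
  (forall y i T U a b, TERM_Gen B T (FEx a) -> P T (FEx a) ->
    TERM_Gen B U b -> P U b ->
    y \notin fv_fm (FEx a) -> y \notin fv_fm b ->
    (forall p, p \in FVT U -> p != (i, inst_fm (Var y) a) ->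
      y \notin fv_fm p.2) ->
    P (exE y i a T U) b) ->
  (forall T a, FORM_L a -> TERM_Gen B T FBot -> P T FBot -> P (GBotE a T) a) ->
  forall T a, TERM_Gen B T a -> P T a.
Proof.
rewrite /TERM_Gen => *; match goal with H : typed _ _ _ _ |- _ =>
  move: H; move Ee: false => e H; elim: H Ee => {e} end;
  by move=> *; subst=> //; eauto.
Qed.

Lemma typed_true T a : TERM_Gen B T a -> typed B true T a.
Proof.
elim/TERM_Gen_ind => *; [exact: ty_const|exact: ty_var|exact: ty_andI|
  exact: ty_andE|exact: ty_orI|exact: ty_orE|exact: ty_impI|apply: ty_impE; eassumption|
  exact: ty_allI|exact: ty_allE|exact: ty_exI|exact: ty_exE|exact: ty_botE].
Qed.

(** A derivation ends in an atomic formula or in an instance of one by terms of the language, and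
    such instances are again well formed. *)
Lemma concl_wf d : closed_DER B d -> FORM_L (concl d).
Proof.
have hatom S a : atom S a -> FORM_L a.
  by case/orP => [/eqP -> //|]; case: a => // r ts /and3P[].
case=> hd _ _; case: hd => [a|r s ds hr hs _ _] /=; first exact: hatom.
apply: wf_sub => [x|]; first by case/andP: (hs x).
by case: (as_production hr) => _ h _; exact: hatom h.
Qed.

Lemma typed_wf e T a : typed B e T a -> FORM_L a.
Proof.
elim=> {e T a}; rewrite /FORM_L //= => e.
- exact: concl_wf.
- by move=> i a t _ ha ht; exact: wf_inst.
- by move=> T U a b _ -> _ ->.
- by move=> s T a b _ /andP[ha hb]; case: s.
- by move=> i T a b -> _ ->.
- by move=> T U a b _ /andP[].
- by move=> x T a _ ha _; exact: wf_close.
- by move=> T a t _ ha ht; exact: wf_inst.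
Qed.

Lemma typed_lc T a : TERM_Gen B T a -> lc 0 0 T.
Proof.
elim/TERM_Gen_ind => {T a}; rewrite /FORM_L //=.
- by move=> T U a b _ -> _ ->.
- by move=> s T a b /andP[ha hb] _ hT; apply/and3P.
- move=> i j T U Z a b c hT lT _ lU _ lZ; have /andP[ha hb] := typed_wf hT.
  by rewrite lT !lc_close_t // !andbT; apply/andP.
- by move=> i T a b -> _ hT; rewrite lc_close_t.
- by move=> T U a b _ -> _ ->.
- by move=> x T a _ hT _; rewrite lc_close_i.
- move=> T a t hT lT ht; have ha : wf_fm 1 a := typed_wf hT.
  by rewrite lT andbT; apply/andP; split=> //; exact: wf_inst.
- by move=> T a t ha ht _ ->; rewrite ha !andbT; exact: wf_inst.
- move=> y i T U a b hT -> _ lU _ _ _; have ha : wf_fm 1 a := typed_wf hT.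
  by rewrite ha /= /bind_ex /close_gt /act_term lc_close_i // lc_close_t.
- by move=> T a -> _ ->.
Qed.

(** Renaming indices leaves all types untouched, hence also the side conditions on individual
    variables; binders are handled by commuting [ren] with closing. *)
Lemma typed_ren s T a : (forall b, injective (s^~ b)) ->
  TERM_Gen B T a -> TERM_Gen B (act_term (ren s) T) a.
Proof.
move=> inj; rewrite /act_term; elim/TERM_Gen_ind => {T a};
  try by move=> *; rewrite /= ?act_fm_id //; econstructor; eauto.
- move=> i j T U Z a b c _ hT _ hU _ hZ; rewrite /= !act_fm_id //.
  rewrite !(ren_depth _ _ _ _ 0 1 0 0) !ren_close_t //; exact: ty_orE.
- move=> i T a b ha _ hT; rewrite /= !act_fm_id //.
  rewrite (ren_depth _ _ _ _ 0 1 0 0) ren_close_t //; exact: ty_impI.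
- move=> x T a _ hT hx; rewrite /= (ren_depth _ _ _ _ 1 0 0 0) ren_close_i //.
  apply: ty_allI => // p; rewrite FVT_ren => /mapP[q hq ->]; exact: (hx q).
move=> y i T U a b _ hT _ hU hya hyb hy.
rewrite /= act_fm_id // (ren_depth _ _ _ _ 1 1 0 0) ren_close_i; last first.
  (* Closing over the bound typed-variable removes the only type in which [y] may occur. *)
  by move=> p; rewrite FVT_close_t mem_filter => /andP[ne hp]; exact: hy.
rewrite ren_close_t //; apply: ty_exE => // p; rewrite FVT_ren => /mapP[q hq ->] ne.
by apply: (hy q) => //; apply: contra ne => /eqP ->.
Qed.

Lemma typed_rename i k a T c :
  TERM_Gen B T c -> (k, a) \notin FVT T ->
  TERM_Gen B (subT_gt (xi k a) i a T) c.
Proof.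
move=> hT fk.
(* Sending [i] to [k] is in general not injective. The transposition of [i] and [k] at type [a] is,
   and it agrees with the substitution on [T], where [k] is not free. *)
pose s j b := if b == a then if j == i then k else if j == k then i else j else j.
have inj b : injective (s^~ b).
  move=> m n; rewrite /s; case: ifP => // _.
  by do ![case: eqP] => //; congruence.
have <- : act_term (ren s) T = subT_gt (xi k a) i a T; last exact: typed_ren.
rewrite /subT_gt /close_gt /act_term open_close_t ?(typed_lc hT) //.
have -> : xi k a = xi (s i a) a by rewrite /s !eqxx.
rewrite subst_t_ren // => -[j b] hp; rewrite xpair_eqE /s /=.
case: (eqVneq b a) => // eb; rewrite andbT => /negbTE ->.
by case: eqP => // ej; rewrite -ej -eb hp in fk.
Qed.

Lemma subT_id W i a T c :
  TERM_Gen B T c -> ((i, a) \in FVT T -> W = xi i a) -> subT_gt W i a T = T.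
Proof.
move=> hT h; rewrite /subT_gt /close_gt /act_term open_close_t ?(typed_lc hT) //.
exact: subst_t_id.
Qed.

(** The bound variables are put back for themselves, so that the equation for [exE] on a canonical
    argument ends in the minor argument itself. *)
Lemma sub_ex_id y i a T c :
  TERM_Gen B T c -> sub_ex (Var y) (xi i (inst_fm (Var y) a)) y i a T = T.
Proof.
move=> hT; have lT := typed_lc hT.
rewrite /sub_ex /bind_ex /act_term (@gt_closeK_i _ _ _ _ _ _ _ 1).
  by apply: (subT_id hT).
exact: lc_close_t.
Qed.

End Typing.

(** * Contexts of typing assumptions, freshness and substitution in [GG] *)

Section Derivations.
Variables (L : language) (B : atomic_base L).
Implicit Types (T U V W : gterm L) (a b c : form L).
Implicit Types (A C : gform L) (G : seq (gform L)).
Implicit Types (p : nat * form L) (s : seq (nat * form L)).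

(** Contexts of the form [map decl s] reduce weakening and freshness to membership in the list
    [s]. *)
Definition decl p : gform L := PGr (xi p.1 p.2) p.2.

Lemma In_decl p s : p \in s -> List.In (decl p) (map decl s).
Proof. by elim: s => //= q s IH; rewrite inE => /predU1P[->|/IH]; [left|right]. Qed.

Lemma decl_In A s : List.In A (map decl s) -> exists2 p, p \in s & A = decl p.
Proof.
elim: s => //= q s IH [<-|/IH[p hp ->]]; first by exists q; rewrite ?mem_head.
by exists p; rewrite // inE hp orbT.
Qed.

Lemma incl_decl s s' : {subset s <= s'} -> List.incl (map decl s) (map decl s').
Proof. by move=> h A /decl_In[p hp ->]; apply/In_decl/h. Qed.

Lemma free_in_T i a T b : free_in (VT i a) (PGr T b) = ((i, a) \in FVT T).
Proof. by rewrite /= cats0. Qed.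

Lemma fresh_T i a s : (i, a) \notin s -> fresh (VT i a) (map decl s).
Proof.
move=> h A /decl_In[p hp ->]; rewrite /= inE -surjective_pairing.
by apply: contra h => /eqP ->.
Qed.

Lemma fresh_I x s :
  (forall p, p \in s -> x \notin fv_fm p.2) -> fresh (VI x) (map decl s).
Proof. by move=> h A /decl_In[p hp ->]; rewrite /= mem_cat orbb; exact: h. Qed.

Lemma fresh_cons v A G : ~~ free_in v A -> fresh v G -> fresh v (A :: G).
Proof. by move=> hA hG D /= [<-|/hG]. Qed.

(** The index is fresh at all types at once, so that a single one can serve both disjuncts of a
    disjunction. *)
Lemma fresh_index s : exists k, forall a, (k, a) \notin s.
Proof.
exists (\max_(p <- s) p.1).+1 => a; apply/negP => h.
by have := leq_bigmax_seq (P := xpredT) (F := fst) _ h isT; rewrite ltnn.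
Qed.

Lemma fresh_nat (r : seq nat) : exists x, x \notin r.
Proof.
exists (\max_(y <- r) y).+1; apply/negP => h.
by have := leq_bigmax_seq (P := xpredT) (F := id) _ h isT; rewrite ltnn.
Qed.

Lemma subT_xi W i a : subT_gt W i a (xi i a) = W.
Proof. by rewrite /subT_gt /close_gt /act_term /= act_fm_id // !eqxx. Qed.

Lemma subT_gf_Gr W i a T b :
  subT_gf W i a (PGr T b) = PGr (subT_gt W i a T) b.
Proof. by rewrite /subT_gf /act_form /= !act_fm_id. Qed.

Lemma subT_gf_Imp W i a A C :
  subT_gf W i a (PImp A C) = PImp (subT_gf W i a A) (subT_gf W i a C).
Proof. by []. Qed.

Lemma wf_PGr T a : TERM_Gen B T a -> wf_gf B (PGr T a).
Proof. by move=> hT; apply/wf_Gr/typed_true. Qed.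

Lemma wf_decl i a : FORM_L a -> wf_gf B (PGr (xi i a) a).
Proof. by move=> ha; apply/wf_Gr/ty_var. Qed.

(** The generalisation takes place over [G], where the typed-variable is fresh; the larger [G'], in
    which [W] is typed, may contain it free. *)
Lemma GG_subst i a c W U G G' :
  TERM_Gen B W a -> TERM_Gen B U c ->
  GG B (PGr (xi i a) a :: G) (PGr U c) -> fresh (VT i a) G ->
  List.incl G G' -> GG B G' (PGr W a) -> GG B G' (PGr (subT_gt W i a U) c).
Proof.
move=> hW hU dU fG iG dW.
have ha : FORM_L a := typed_wf hW.
have wA : wf_gf B (PImp (PGr (xi i a) a) (PGr U c)).
  by apply: wf_Imp; [exact: wf_decl | exact: wf_PGr].
have := GG_AllE wA (GG_AllI (v := VT i a) ha (GG_ImpI (wf_decl i ha) dU) fG)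
  (inst_T _ _ hW).
rewrite subT_gf_Imp !subT_gf_Gr subT_xi => h.
exact: GG_ImpE (GG_weak iG h) dW.
Qed.


(** * Typing the eliminating symbols in [GG] *)

Ltac incl := move=> ?; rewrite /= ?List.in_app_iff /=; tauto.

Lemma GG_andE (k : bool) G T a b :
  TERM_Gen B T (FAnd a b) -> GG B G (PGr T (FAnd a b)) ->
  GG B G (PGr (GAndE k T) (if k then a else b)).
Proof.
move=> hT dT; have /andP[ha hb] := typed_wf hT.
(* The proper variables must avoid [T], which occurs in the conclusion. *)
have [i fi] := fresh_index (FVT T).
(* Adding [(i, a)] keeps the two variables distinct even when [a] and [b] coincide. *)
have [j fj] := fresh_index ((i, a) :: FVT T).
have ne : (i, a) != (j, b).
  by apply/eqP => e; have := fj b; rewrite -e mem_head.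
have {}fj : (j, b) \notin FVT T by have := fj b; rewrite inE => /norP[].
rewrite -[G]cats0; apply: (GG_Dand (i := i) (j := j) dT _ ne).
- have tI : typed B true (GAndI (xi i a) (xi j b)) (FAnd a b).
    by apply: ty_andI; exact: ty_var.
  have wE : wf_gf B (PEqv T (GAndI (xi i a) (xi j b))).
    by apply: wf_Eqv tI; exact: typed_true.
  have tk : typed B true (if k then xi i a else xi j b) (if k then a else b).
    by case: k; exact: ty_var.
  apply: (GG_pres (U := if k then xi i a else xi j b)).
    apply: (GG_trans (U := GAndE k (GAndI (xi i a) (xi j b)))).
      apply: GG_c_andE; last by apply: GG_asm => //; left.
      apply: (wf_Eqv (a := if k then a else b)); last exact: ty_andE tI.
      exact/ty_andE/typed_true.
    by apply: GG_e_and; apply: wf_Eqv tk; exact: ty_andE tI.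
  by case: k {tk}; apply: GG_asm => /=;
    by [exact: wf_decl | auto 6].
- by apply: fresh_cons => //; rewrite free_in_T; exact: fi.
- by apply: fresh_cons => //; rewrite free_in_T.
Qed.

(** Both minor premises of [GG_Dor] at once: [n] is bound in the chosen branch and [m] is the proper
    variable. They are kept apart because [n] may be free in [T], hence in the conclusion. *)
Lemma orE_branch (k : bool) i a j b T U V c m n G :
  let d := if k then a else b in
  TERM_Gen B T (FOr a b) -> TERM_Gen B U c -> TERM_Gen B V c ->
  n = (if k then i else j) -> (m, d) \notin FVT (if k then U else V) ->
  GG B (PGr (xi n d) d :: G) (PGr (if k then U else V) c) -> fresh (VT n d) G ->
  GG B [:: PEqv T (GOrI k a b (xi m d)), PGr (xi m d) d & G]
     (PGr (orE i a j b T U V) c).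
Proof.
move=> d hT hU hV en fm dk fG.
have hab := typed_wf hT; have /andP[ha hb] := hab.
have hd : FORM_L d by rewrite /d; case: (k).
have hI : TERM_Gen B (GOrI k a b (xi m d)) (FOr a b).
  by apply: ty_orI => //; exact: ty_var.
have wE : wf_gf B (PEqv T (GOrI k a b (xi m d))).
  by apply: wf_Eqv; apply: typed_true; eassumption.
have hk : TERM_Gen B (if k then U else V) c by case: (k).
have hS := typed_rename n hk fm.
have eS : (if k then subT_gt (xi m d) i a U else subT_gt (xi m d) j b V) =
          subT_gt (xi m d) n d (if k then U else V) by rewrite en /d; case: (k).
have tE := ty_orE i j (typed_true hI) (typed_true hU) (typed_true hV).
apply: (GG_pres (U := subT_gt (xi m d) n d (if k then U else V))).
  apply: (GG_trans (U := orE i a j b (GOrI k a b (xi m d)) U V)).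
    have wR W e : TERM_Gen B W e -> wf_gf B (PEqv W W).
      by move=> hW; apply: wf_Eqv; apply: typed_true; exact: hW.
    apply: GG_c_orE.
    - apply: wf_Eqv tE;
      exact: (ty_orE i j (typed_true hT) (typed_true hU) (typed_true hV)).
    - by apply: GG_asm => //; left.
    - exact/GG_refl/(wR _ _ hU).
    - exact/GG_refl/(wR _ _ hV).
  rewrite -eS; apply: GG_e_or; first exact: ty_var.
  by apply: wf_Eqv tE _; rewrite eS; exact: typed_true.
apply: (GG_subst _ hk dk fG); first exact: ty_var.
  by incl.
by apply: GG_asm; [exact: wf_decl | rewrite /=; auto].
Qed.


Lemma fresh_decl_fun v s :
  match v with VH _ _ | VF _ _ => True | _ => False end -> fresh v (map decl s).
Proof. by case: v => // i a _ A /decl_In[p hp ->]. Qed.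

Lemma GG_impE s s' T U a b :
  TERM_Gen B T (FImp a b) -> TERM_Gen B U a ->
  GG B (map decl s) (PGr T (FImp a b)) -> GG B (map decl s') (PGr U a) ->
  GG B (map decl (s ++ s')) (PGr (GImpE T U) b).
Proof.
move=> hT hU dT dU; have /andP[ha hb] := typed_wf hT; rewrite map_cat.
(* Index 0 serves twice: the typed-variable is bound in both discharged assumptions, and neither [T]
   nor [U] contains functional variables. *)
set Z := impI 0 a (fapp 0 b (xi 0 a)).
set H := PImp (PGr (xi 0 a) a) (PGr (fapp 0 b (xi 0 a)) b).
have tf W : TERM_Gen B W a -> typed B true (fapp 0 b W) b.
  by move=> hW; exact: ty_f hW.
have wH : wf_gf B H.
  by apply: wf_Imp; [exact: wf_decl | apply/wf_Gr/tf/ty_var].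
have tZ : typed B true Z (FImp a b) by apply: ty_impI => //; apply/tf/ty_var.
have tZU : typed B true (GImpE Z U) b := ty_impE tZ (typed_true hU).
(* Substitution enters the argument of the functional variable, so the equation for [GImpE] on [Z]
   ends in [fapp 0 b U]. *)
have eF : subT_gt U 0 a (fapp 0 b (xi 0 a)) = fapp 0 b U.
  rewrite /subT_gt /close_gt /act_term /= /keep_f /= !act_fm_id //.
  by rewrite eqxx.
apply: (GG_Dimp (i := 0) (k := 0) dT).
  apply: (GG_pres (U := fapp 0 b U)).
    apply: (GG_trans (U := GImpE Z U)).
      apply: GG_c_impE.
      - apply: wf_Eqv tZU; exact: ty_impE (typed_true hT) (typed_true hU).
      - by apply: GG_asm; [apply: wf_Eqv tZ; exact: typed_true | left].
      - by apply/GG_refl/(wf_Eqv (a := a)); exact: typed_true.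
    rewrite -eF; apply: GG_e_imp => //; rewrite eF.
    apply: wf_Eqv tZU _; exact: tf.
  have wQ : wf_gf B (pAll (VT 0 a) H) by exact: wf_Q.
  have eH : subT_gf U 0 a H = PImp (PGr U a) (PGr (fapp 0 b U) b).
    by rewrite -[in RHS]eF subT_gf_Imp !subT_gf_Gr subT_xi.
  (* The second discharged assumption, instantiated with [U], turns the typing of [U] into that of
     [fapp 0 b U]. *)
  apply: (@GG_ImpE _ _ _ (PGr U a)).
    rewrite -eH.
    by apply: GG_AllE wH (GG_asm wQ _) (inst_T _ _ hU); right; left.
  by apply: (GG_weak _ dU); incl.
apply: fresh_cons; last exact: fresh_decl_fun.
by rewrite /= (lc_no_fun _ _ (typed_lc hT)) (lc_no_fun _ _ (typed_lc hU)).
Qed.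

Lemma GG_allE G T a t :
  TERM_Gen B T (FAll a) -> TERM_L t -> GG B G (PGr T (FAll a)) ->
  GG B G (PGr (GAllE (FAll a) (inst_fm t a) T) (inst_fm t a)).
Proof.
move=> hT ht dT; have ha : wf_fm 1 a := typed_wf hT.
(* [x] is bound in both assumptions discharged by [GG_Dall], so it has to avoid [a] only. *)
have [x hx] := fresh_nat (fv_fm a).
set Z := allI x (happ 0 a (Var x)).
set H := PGr (happ 0 a (Var x)) (inst_fm (Var x) a).
have th u : TERM_L u -> typed B true (happ 0 a u) (inst_fm u a).
  by move=> hu; exact: ty_h.
have wH : wf_gf B H by apply/wf_Gr/th.
have eb : bind_fm x (inst_fm (Var x) a) = a by exact: bind_inst.
have tZ : typed B true Z (FAll a).
  by rewrite -[in FAll a]eb; apply: ty_allI; first exact: th.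
have tZt := ty_allE tZ ht.
(* The type [a] of the functional variable is a body without [x], so only the argument changes. *)
have eH : subI_gt t x (happ 0 a (Var x)) = happ 0 a t.
  rewrite /subI_gt /close_gt /act_term /= /keep_h /happ /= /act_fm /=.
  rewrite fm_close_fresh // fm_open_wf //.
  by rewrite /close_var eqxx /= /open_var /= lift_tm0.
rewrite -[G]cats0; apply: (GG_Dall (k := 0) dT hx).
  apply: (GG_pres (U := happ 0 a t)).
    apply: (GG_trans (U := GAllE (FAll a) (inst_fm t a) Z)).
      apply: GG_c_allE.
      - apply: wf_Eqv tZt; exact: ty_allE (typed_true hT) ht.
      - by apply: GG_asm; [apply: wf_Eqv tZ; exact: typed_true | left].
    have := @GG_e_all _ B [:: PEqv T Z; pAll (VI x) H] x
      (inst_fm (Var x) a) t (happ 0 a (Var x)) ht.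
    rewrite /= /fAll eb eH; apply; exact: wf_Eqv tZt (th _ ht).
  have wQ : wf_gf B (pAll (VI x) H) by exact: wf_Q.
  have eI : subI_gf t x H = PGr (happ 0 a t) (inst_fm t a).
    by rewrite -eH -[in inst_fm t a]eb.
  rewrite -eI.
  by apply: (GG_AllE wH (GG_asm wQ _) (inst_I _ _ _ ht)); right; left.
apply: fresh_cons => //.
by rewrite /= (lc_no_fun _ _ (typed_lc hT)).
Qed.

Lemma GG_orE i a j b T U V c :
  TERM_Gen B T (FOr a b) -> TERM_Gen B U c -> TERM_Gen B V c ->
  GG B (map decl (FVT T)) (PGr T (FOr a b)) ->
  GG B (map decl (FVT U)) (PGr U c) -> GG B (map decl (FVT V)) (PGr V c) ->
  GG B (map decl (FVT (orE i a j b T U V))) (PGr (orE i a j b T U V) c).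
Proof.
move=> hT hU hV dT dU dV.
have [m hm] := fresh_index (FVT T ++ FVT U ++ FVT V).
have fm d : [/\ (m, d) \notin FVT T, (m, d) \notin FVT U & (m, d) \notin FVT V].
  by have := hm d; rewrite !mem_cat !negb_or => /and3P[].
(* The context left to a branch once its bound variable is discharged. *)
pose F n d W := [seq p <- FVT W | p != (n, d)].
have fF n d W : fresh (VT n d) (map decl (F n d W)).
  by apply: fresh_T; rewrite mem_filter eqxx.
have dF n d W e : GG B (map decl (FVT W)) (PGr W e) ->
    GG B (PGr (xi n d) d :: map decl (F n d W)) (PGr W e).
  apply: GG_weak; apply: (@incl_decl _ ((n, d) :: F n d W)) => p hp.
  by rewrite inE mem_filter hp andbT orbN.
have eC : FVT (orE i a j b T U V) = FVT T ++ F i a U ++ F j b V.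
  by rewrite /F -!(FVT_close_t _ _ _ 0 0 0 0).
have fC d : (m, d) \notin FVT (orE i a j b T U V).
  by case: (fm d) => h1 h2 h3;
    rewrite eC !mem_cat !mem_filter !negb_or !negb_and h1 h2 h3 !orbT.
have fFm d n e W : (m, d) \notin FVT W -> fresh (VT m d) (map decl (F n e W)).
  by move=> h; apply: fresh_T; rewrite mem_filter negb_and h orbT.
rewrite eC !map_cat; apply: (GG_Dor (i := m) (j := m) dT).
- by apply: (orE_branch (k := true) hT hU hV erefl);
    [case: (fm a) | exact: dF | ].
- by apply: (orE_branch (k := false) hT hU hV erefl);
    [case: (fm b) | exact: dF | ].
- apply: fresh_cons; first by rewrite free_in_T.
  by apply: fFm; case: (fm a).
- apply: fresh_cons; first by rewrite free_in_T.
  by apply: fFm; case: (fm b).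
Qed.


(* T is first replaced by a fresh typed-variable of the same type: then y and
   the i-th typed-variable of type a(y) are not free in the conclusion, and
   serve as proper variables of the elimination without being renamed. *)
Lemma GG_exE y i a T U b :
  TERM_Gen B T (FEx a) -> TERM_Gen B U b ->
  y \notin fv_fm (FEx a) -> y \notin fv_fm b ->
  (forall p, p \in FVT U -> p != (i, inst_fm (Var y) a) ->
    y \notin fv_fm p.2) ->
  GG B (map decl (FVT T)) (PGr T (FEx a)) ->
  GG B (map decl (FVT U)) (PGr U b) ->
  GG B (map decl (FVT (exE y i a T U))) (PGr (exE y i a T U) b).
Proof.
move=> hT hU hya hyb hy dT dU.
have wT : FORM_L (FEx a) := typed_wf hT.
have wa : wf_fm 1 a := wT.
set ay := inst_fm (Var y) a in hy *.
have way : FORM_L ay by exact: wf_inst.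
(* [z] must differ from the proper variable and be absent from [U]; occurrences in [T] are harmless,
   as [T] is only put in for [z] at the end. *)
have [m fm] := fresh_index ((i, ay) :: FVT U).
have [fmi fmU] : (m, FEx a) != (i, ay) /\ (m, FEx a) \notin FVT U.
  by apply/andP; rewrite -negb_or -in_cons.
set F := [seq p <- FVT U | p != (i, ay)].
have yF p : p \in F -> y \notin fv_fm p.2.
  by rewrite mem_filter => /andP[ne hp]; exact: hy.
have eF : FVT (bind_ex y i a U) = F.
  by rewrite /bind_ex /close_gt /act_term FVT_close_i FVT_close_t.
have eC V : FVT (exE y i a V U) = FVT V ++ F by rewrite -eF.
set z := xi m (FEx a).
have tz : TERM_Gen B z (FEx a) by exact: ty_var.
have tE : TERM_Gen B (exE y i a z U) b by exact: ty_exE tz hU hya hyb hy.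
have dz : GG B (PGr z (FEx a) :: map decl F) (PGr (exE y i a z U) b).
  set E := GExI ay (FEx a) (xi i ay).
  have tI : TERM_Gen B E (FEx a) by apply: ty_exI => //; exact: ty_var.
  have tEI : TERM_Gen B (exE y i a E U) b by exact: ty_exE tI hU hya hyb hy.
  have dm : GG B [:: PGr z (FEx a)] (PGr z (FEx a)).
    by apply: GG_asm; [exact: wf_PGr | left].
  apply: (GG_Dex (G := [:: _]) (x := y) (i := i) dm hya).
  - apply: (GG_pres (U := U)).
      apply: (GG_trans (U := exE y i a E U)).
        apply: GG_c_exE.
        + by apply: wf_Eqv; apply: typed_true; eassumption.
        + apply: GG_asm; last by left.
          by apply: wf_Eqv; apply: typed_true; eassumption.
        + by apply: GG_refl; apply: wf_Eqv; apply: typed_true; eassumption.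
      have eU : sub_ex (Var y) (xi i ay) y i a U = U := sub_ex_id y i a hU.
      have := @GG_e_ex _ B [:: PEqv z E, decl (i, ay) & map decl F]
        y i a (Var y) (xi i ay) U.
      rewrite eU; apply=> //; first exact: ty_var.
      by apply: wf_Eqv; apply: typed_true; eassumption.
    apply: (GG_weak _ dU) => A /decl_In[p hp ->].
    have [->|ne] := eqVneq p (i, ay); first by right; left.
    by right; right; apply: In_decl; rewrite mem_filter ne.
  (* In the conclusion, [bind_ex] has closed over [y], and the types [FEx a] and [b] avoid it. *)
  - apply: fresh_cons; last exact: fresh_I.
    rewrite /= !mem_cat !negb_or hya hyb andbT /=.
    exact: notin_close_i.
  - apply: fresh_cons; last by apply: fresh_T; rewrite mem_filter eqxx.
    rewrite free_in_T eC mem_cat negb_or mem_filter eqxx andbT.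
    by rewrite inE eq_sym.
have fF : fresh (VT m (FEx a)) (map decl F).
  by apply: fresh_T; rewrite mem_filter negb_and fmU orbT.
(* [z] occurs only as the major argument, so the substitution leaves [U] as it is. *)
have eT : exE y i a T U = subT_gt T m (FEx a) (exE y i a z U).
  rewrite /exE /z /subT_gt /close_gt {1 2}/act_term /= !act_fm_id // !eqxx /=.
  rewrite open_close_t.
    by rewrite subst_t_id // eF mem_filter (negbTE fmU) andbF.
  by rewrite /bind_ex /close_gt /act_term lc_close_i // lc_close_t // (typed_lc hU).
rewrite eC map_cat eT; apply: (GG_subst hT tE dz fF).
  by move=> A hA; apply/List.in_app_iff; right.
by apply: GG_weak dT => A hA; apply/List.in_app_iff; left.
Qed.

(** * The induction on terms of [Gen] *)

Lemma TERM_Gen_GG U b : TERM_Gen B U b -> GG B (map decl (FVT U)) (PGr U b).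
Proof.
have inclL s s' : List.incl (map decl s) (map decl (s ++ s')).
  by apply: incl_decl => p; rewrite mem_cat => ->.
have inclR s s' : List.incl (map decl s') (map decl (s ++ s')).
  by apply: incl_decl => p; rewrite mem_cat orbC => ->.
elim/TERM_Gen_ind => {U b}.
- by move=> d hd; exact: GG_const.
- by move=> i a ha; apply: GG_asm; [exact: wf_decl | left].
- move=> T U a b _ dT _ dU; apply: GG_andI.
    exact: GG_weak (inclL _ _) dT.
  exact: GG_weak (inclR _ _) dU.
- by move=> k T a b hT dT; exact: GG_andE.
- move=> k T a b hab hT dT; apply: GG_orI => //.
  by apply: wf_PGr; exact: ty_orI.
- move=> i j T U V a b c hT dT hU dU hV dV; exact: GG_orE.
- move=> i T a b ha hT dT; apply: GG_impI => //.
    (* Weakening puts [(i, a)] in front of the context whether or not it is free in [T], so vacuous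
       discharge is included. *)
    apply: GG_weak dT;
    apply: (@incl_decl _ ((i, a) :: FVT (impI i a T))) => p hp.
    by rewrite inE [FVT _]FVT_close_t mem_filter hp andbT orbN.
  by apply: fresh_T; rewrite [FVT _]FVT_close_t mem_filter eqxx.
- by move=> T U a b hT dT hU dU; exact: (GG_impE hT hU dT dU).
- move=> x T a hT dT hx; apply: GG_allI.
  + by apply: wf_PGr; exact: ty_allI.
  + by rewrite [FVT _]FVT_close_i //.
  + by rewrite [FVT _]FVT_close_i //; exact: fresh_I.
- by move=> T a t hT dT ht; exact: GG_allE.
- by move=> T a t ha ht hT dT; exact: GG_exI.
- by move=> y i T U a b hT dT hU dU hya hyb hy; exact: GG_exE.
(* [GBotE] has no equation: absurdity of the enriched language yields the typing directly. *)
- move=> T a ha hT dT; apply: GG_BotE; last exact: GG_bot dT.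
  by apply: wf_PGr; exact: ty_botE.
Qed.

End Derivations.

Theorem theorem3 (L : language) (B : atomic_base L) (U : gterm L) (b : form L)
    (xs : seq (nat * form L)) :
  TERM_Gen B U b ->
  FVT U =i xs ->
  GG B [seq PGr (xi p.1 p.2) p.2 | p <- xs] (PGr U b).
Proof.
(* Weakening compares contexts as sets, so [xs] may list the variables in any order and with
   repetitions. *)
move=> hU eU; apply: GG_weak (TERM_Gen_GG hU).
by apply: incl_decl => p; rewrite eU.
Qed.
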